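(* There exist absolute constants $C>0$ and $C_0>0$ such that for every prime number $p$ there exist positive integers $q$ and $a$ with $0<a<q$, $\gcd(a,q)=1$, $q\equiv 0\pmod p$ and $q\le C_0\,p^{C}$, such that all partial quotients of the continued fraction expansion of $a/q$ are bounded by $2$.
   Context: For coprime positive integers $0<a<q$, the rational number $a/q$ is uniquely represented as a regular continued fraction $$\frac{a}{q}=[0;b_1,\dots,b_s]=\cfrac{1}{b_1+\cfrac{1}{b_2+\cdots+\cfrac{1}{b_s}}},\qquad b_s\ge 2,$$ with positive integers $b_1,\dots,b_s$, called the partial quotients of $a/q$. ''All partial quotients are bounded by $2$'' means $b_j\le 2$ for all $1\le j\le s$. *)

(* Defs.v *)
From mathcomp Require Import all_boot all_order all_algebra.
From mathcomp Require Import reals exp.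

Set Implicit Arguments.
Unset Strict Implicit.
Unset Printing Implicit Defensive.

Import Order.TTheory GRing.Theory Num.Theory.
Local Open Scope ring_scope.

(* [cf_value [:: b1; ...; bs]] is [0; b1, ..., bs] =
   1 / (b1 + 1 / (b2 + ... + 1 / bs)).  The empty sequence has value 0, so that
   the innermost denominator is bs + 0. *)
Fixpoint cf_value (b : seq nat) : rat :=
  if b is b1 :: b' then (b1%:R + cf_value b')^-1 else 0.

(* The normalisation bs >= 2 makes the expansion of a rational in ]0, 1[ unique.
   It also excludes the empty sequence, for which [last 0 b] is 0. *)
Definition is_cf_expansion (x : rat) (b : seq nat) : Prop :=
  [/\ all (fun bj => 0 < bj)%N b, (2 <= last 0 b)%N & x = cf_value b].

Definition partial_quotients_bounded (x : rat) (M : nat) : Prop :=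
  exists2 b : seq nat, is_cf_expansion x b & all (fun bj => bj <= M)%N b.

(* Main.v *)
Require Import Defs.
From mathcomp Require Import all_boot all_order all_algebra.
From mathcomp Require Import reals exp.
From mathcomp Require Import classical_sets.
From mathcomp Require Import zify ring lra.
Import Order.TTheory GRing.Theory Num.Theory.
Local Open Scope ring_scope.

(* Consider the words of length m in U = (1 1; 0 1) and L = (1 0; 1 1), acting on
   mean-zero functions on the projective line over F_p (realised as functions on
   F_p^2 that are homogeneous of degree 0).  There are 2^m of them, their average
   size is about (3/2)^m, and they are distinct matrices.  When (3/2)^m is about
   p^(6/5), the number of pairs of words congruent mod p is bounded elementarily:
   for w' = w + p V with V <> 0 fixed, w lies on a conic section of ad - bc = 1,
   which has few integral points by the divisor bound.  Since the mean-zero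
   functions form a representation of dimension p, Schur orthogonality turns this
   into |(U + L)^m| <= 2^m p^(-c) (the Sarnak-Xue multiplicity argument).

   Although U + L is not normal, U = s r and L = - s r^-1 with s, r of orders 2, 3
   in PSL_2, so that U + L lies in the algebra generated by two orthogonal
   projections.  The theory of two projections then yields a uniform spectral gap
   for U and L.  For A_b = (b 1; 1 0) one has A_2 = U A_1 and L = A_1^-1 A_2, so
   the average of f o A_1 and f o A_2, applied twice, is a uniform contraction.
   Hence a path of length O(log p) leads from the line of (2, 1) to the line
   {x = 0}, that is, a continuant of a word in {1, 2} is divisible by p. *)

Set Implicit Arguments.
Unset Strict Implicit.
Unset Printing Implicit Defensive.

(** * The divisor bound *)

(** The falling factorial (e+1)...(e+h) lies above (e+1)^h and equals h! times a binomial
    coefficient of h+e, which is at most 2^(h+e). *)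
Lemma expn_succ_le_exp2 h e : (e.+1 ^ h <= h`! * 2 ^ h * 2 ^ e)%N.
Proof.
have le_ffact : (e.+1 ^ h <= (e + h) ^_ h)%N.
  elim: h => [|h IHh] //; rewrite addnS ffactSS expnS leq_mul //.
  by rewrite ltnS leq_addr.
apply: leq_trans le_ffact _; rewrite -bin_ffact mulnC -mulnA leq_mul2l.
apply/orP; right; rewrite -expnD addnC.
have -> : (2 ^ (h + e) = \sum_(i < (h + e).+1) 'C(h + e, i))%N.
  by rewrite -[2%N]/(1 + 1)%N expnDn; apply: eq_bigr => i _; rewrite !exp1n !muln1.
have hlt : (h < (h + e).+1)%N by rewrite ltnS leq_addr.
by rewrite (bigD1 (Ordinal hlt)) //= leq_addr.
Qed.

Lemma size_divisors_pfactor q e m : prime q -> coprime q m -> (0 < m)%N ->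
  (size (divisors (q ^ e * m)) <= e.+1 * size (divisors m))%N.
Proof.
move=> q_pr co_qm m_gt0.
pose L := [seq (q ^ i * d)%N | i <- iota 0 e.+1, d <- divisors m].
have <- : size L = (e.+1 * size (divisors m))%N by rewrite size_allpairs size_iota.
apply: uniq_leq_size; first exact: divisors_uniq.
move=> d; rewrite -dvdn_divisors; last by rewrite muln_gt0 expn_gt0 prime_gt0.
move=> dv; have d_gt0 : (0 < d)%N.
  by apply: dvdn_gt0 dv; rewrite muln_gt0 expn_gt0 prime_gt0.
have [k co_qk Ed] := pfactor_coprime q_pr d_gt0.
apply/allpairsP; exists (logn q d, k); split; last by rewrite mulnC.
  rewrite mem_iota add0n ltnS /=.
  have qe_gt0 : (0 < q ^ e)%N by rewrite expn_gt0 prime_gt0.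
  have n_gt0 : (0 < q ^ e * m)%N by rewrite muln_gt0 qe_gt0.
  have := dvdn_leq_log q n_gt0 dv.
  by rewrite lognM // pfactorK // (logn_coprime co_qm) addn0.
rewrite -dvdn_divisors // -(@Gauss_dvdr _ (q ^ e)).
  by apply: dvdn_trans dv; rewrite Ed dvdn_mulr.
by rewrite coprime_sym coprimeXl.
Qed.

(** By multiplicativity, a prime power q^e exactly dividing n contributes (e+1)^h on the left. This
    is at most 2^(eh) <= q^e when q >= 2^h, and at most h! 2^h q^e otherwise; at most 2^h primes are
    of the second kind, so the total loss does not depend on n. *)
Lemma divisor_bound h : exists B, forall n, (0 < n)%N ->
  (size (divisors n) ^ h <= B * n)%N.
Proof.
pose B := (h`! * 2 ^ h)%N.
have B_gt0 : (0 < B)%N by rewrite muln_gt0 fact_gt0 expn_gt0.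
pose c n := size [seq q <- primes n | (q < 2 ^ h)%N].
have c_le n : (c n <= 2 ^ h)%N.
  rewrite -(size_iota 0 (2 ^ h)); apply: uniq_leq_size.
    by rewrite filter_uniq ?primes_uniq.
  by move=> q; rewrite mem_filter mem_iota /= add0n => /andP[].
have main n : (0 < n)%N -> (size (divisors n) ^ h <= B ^ c n * n)%N.
  elim/ltn_ind: n => n IHn n_gt0.
  have [n_le1|n_gt1] := leqP n 1.
    have -> : n = 1%N by apply/eqP; rewrite eqn_leq n_le1.
    by rewrite exp1n muln1 expn_gt0 B_gt0.
  pose q := pdiv n; have q_pr : prime q := pdiv_prime n_gt1.
  have [m co_qm En] := pfactor_coprime q_pr n_gt0.
  set e := logn q n in En.
  have e_gt0 : (0 < e)%N by rewrite logn_gt0 mem_primes q_pr n_gt0 pdiv_dvd.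
  have m_gt0 : (0 < m)%N by move: n_gt0; rewrite En muln_gt0 => /andP[].
  have q_gt1 := prime_gt1 q_pr.
  have lt_mn : (m < n)%N.
    rewrite [X in (_ < X)%N]En -{1}[m]muln1 ltn_mul2l m_gt0 /=.
    by rewrite -(expn0 q) ltn_exp2l.
  have /= IHm := IHn m lt_mn m_gt0.
  have sub_primes x : x \in primes m -> (x \in primes n) && (x != q).
    rewrite !mem_primes => /and3P[-> _ xm] /=; rewrite n_gt0 En dvdn_mulr //=.
    apply/eqP => xq; move: xm co_qm; rewrite xq => qm.
    by rewrite prime_coprime // qm.
  have c_mn : (c m + (q < 2 ^ h) <= c n)%N.
    have [q_small|q_big] := ltnP q (2 ^ h).
      rewrite addn1; rewrite /c -/(size (q :: [seq q <- primes m | (q < 2 ^ h)%N])).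
      apply: uniq_leq_size.
        rewrite /= filter_uniq ?primes_uniq // andbT mem_filter negb_and.
        by apply/orP; right; apply/negP => /sub_primes; rewrite eqxx andbF.
      move=> x; rewrite inE => /orP[/eqP ->|]; rewrite mem_filter.
        by rewrite q_small mem_primes q_pr n_gt0 pdiv_dvd.
      by case/andP => xs /sub_primes /andP[xn _]; rewrite mem_filter xs.
    rewrite addn0; apply: uniq_leq_size; first by rewrite filter_uniq ?primes_uniq.
    move=> x; rewrite !mem_filter.
    by case/andP => xs /sub_primes /andP[xn _]; rewrite xs.
  rewrite {1}En mulnC.
  apply: (@leq_trans ((e.+1 * size (divisors m)) ^ h)).
    have [->|h_gt0] := posnP h; first by rewrite !expn0.
    by rewrite leq_exp2r // size_divisors_pfactor.
  have step : (e.+1 ^ h <= B ^ (q < 2 ^ h) * q ^ e)%N.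
    have [q_small|q_big] := ltnP q (2 ^ h).
      rewrite expn1; apply: leq_trans (expn_succ_le_exp2 h e) _.
      by rewrite leq_mul2l leq_exp2r // q_gt1 orbT.
    rewrite mul1n; apply: (@leq_trans ((2 ^ e) ^ h)).
      have [->|h_gt0] := posnP h; first by rewrite !expn0.
      by rewrite leq_exp2r // ltn_expl.
    by rewrite -expnM mulnC expnM leq_exp2r.
  rewrite expnMn; apply: leq_trans (leq_mul step IHm) _.
  rewrite mulnACA -expnD [X in (_ <= _ * X)%N]En [(m * _)%N]mulnC leq_mul2r.
  by rewrite leq_pexp2l ?orbT // addnC.
exists (B ^ (2 ^ h))%N => n n_gt0; apply: leq_trans (main n n_gt0) _.
by rewrite leq_mul2r leq_pexp2l ?orbT.
Qed.

(** * Counting matrices in a box *)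

Lemma size_fiber (T : eqType) (W : seq T) (f : T -> int) (R : nat) :
  (forall w, w \in W -> 0 <= f w <= R%:Z) ->
  size W = (\sum_(k < R.+1) size [seq w <- W | f w == k%:Z])%N.
Proof.
elim: W => [|w W IHW] fW; first by rewrite big1.
rewrite /= IHW; last by move=> v vW; apply: fW; rewrite inE vW orbT.
have /fW : w \in w :: W by rewrite inE eqxx.
case Ef: (f w) => [k|] // /andP[_]; rewrite lez_nat -ltnS => lt_kR.
rewrite (bigD1 (Ordinal lt_kR)) //= [in RHS](bigD1 (Ordinal lt_kR)) //= eqxx /=.
rewrite addSn; congr (_ + _).+1; apply: eq_bigr => i /negbTE ne_i.
case: eqP => // -[] Eki.
by rewrite -(inj_eq val_inj) /= Eki eqxx in ne_i.
Qed.

Lemma size_quadratic_roots (al be ga : int) (s : seq nat) : ga != 0 -> uniq s ->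
  (forall k, k \in s -> al * k%:Z ^+ 2 + be * k%:Z + ga = 0) -> (size s <= 2)%N.
Proof.
move=> ga0 s_uniq s_roots.
pose P : {poly int} := Poly [:: ga; be; al].
have P0 : P != 0.
  apply: contraNneq ga0 => P0.
  by have := coef_Poly [:: ga; be; al] 0; rewrite -/P P0 coef0 /= => <-.
have := @max_poly_roots _ P [seq k%:Z | k <- s] P0; rewrite size_map.
have -> : all (root P) [seq k%:Z | k <- s].
  apply/allP => _ /mapP[k ks ->]; rewrite /root horner_Poly /=.
  by apply/eqP; rewrite -[RHS](s_roots k ks); ring.
rewrite map_inj_uniq; last by move=> i j [].
move=> /(_ isT s_uniq) lt_s; rewrite -ltnS.
by apply: leq_trans lt_s _; apply: (size_Poly [:: ga; be; al]).
Qed.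

(** The tuple (a, b, c, d) stands for the matrix (a b; c d), so [w.1.1.1], [w.1.1.2], [w.1.2], [w.2]
    are a, b, c, d. *)
Notation quad := (int * int * int * int)%type.

Definition qdet (w : quad) := w.1.1.1 * w.2 - w.1.1.2 * w.1.2.

(* The derivative at w of the determinant in the direction V. *)
Definition qpair (V w : quad) :=
  V.2 * w.1.1.1 + V.1.1.1 * w.2 - V.1.2 * w.1.1.2 - V.1.1.2 * w.1.2.

Definition qbox (R : nat) (w : quad) :=
  [&& 0 <= w.1.1.1 <= R%:Z, 0 <= w.1.1.2 <= R%:Z, 0 <= w.1.2 <= R%:Z
    & 0 <= w.2 <= R%:Z].

Lemma size_le_interval (T : eqType) (W : seq T) (f : T -> int) (R : nat) :
  uniq W -> {in W &, injective f} -> (forall w, w \in W -> 0 <= f w <= R%:Z) ->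
  (size W <= R.+1)%N.
Proof.
move=> W_uniq f_inj fW; rewrite -(size_iota 0 R.+1) -(size_map f) -(size_map Posz (iota _ _)).
apply: uniq_leq_size; first by rewrite map_inj_in_uniq.
move=> _ /mapP[w wW ->]; apply/mapP; exists `|f w|%N.
  by rewrite mem_iota add0n /=; have := fW w wW; lia.
by have := fW w wW; lia.
Qed.

Lemma size_le_divisors (T : eqType) (W : seq T) (f : T -> int) (m : int) :
  m != 0 -> uniq W -> {in W &, injective f} -> (forall w, w \in W -> (f w %| m)%Z) ->
  (size W <= 2 * size (divisors `|m|))%N.
Proof.
move=> m0 W_uniq f_inj fW.
pose L := [seq k%:Z | k <- divisors `|m|] ++ [seq - k%:Z | k <- divisors `|m|].
have <- : size L = (2 * size (divisors `|m|))%N by rewrite size_cat !size_map addnn mul2n.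
rewrite -(size_map f); apply: uniq_leq_size; first by rewrite map_inj_in_uniq.
move=> _ /mapP[w wW ->]; have := fW w wW; rewrite dvdzE => dv.
have mem : `|f w|%N \in divisors `|m| by rewrite -dvdn_divisors ?absz_gt0.
rewrite mem_cat; have [f_ge0|f_lt0] := lerP 0 (f w).
  by apply/orP; left; apply/mapP; exists `|f w|%N => //; lia.
by apply/orP; right; apply/mapP; exists `|f w|%N => //; lia.
Qed.

Section Count.
Variables (R D : nat) (x y z t n e : int) (W : seq quad).
Hypotheses (t0 : t != 0) (e0 : e != 0) (W_uniq : uniq W).
Hypothesis W_box : forall w, w \in W -> qbox R w.
Hypothesis W_det : forall w, w \in W -> qdet w = e.
Hypothesis W_lin : forall w, w \in W -> qpair (x, y, z, t) w = n.
Let disc (d : int) := (y * z - t * x) * d ^+ 2 + t * n * d + - (e * t ^+ 2).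
Hypothesis HD : forall k : nat, (k <= R)%N -> disc k%:Z != 0 ->
  (size (divisors `|disc k%:Z|) <= D)%N.

(* For a fixed fourth entry, the linear relation eliminates the first one, and what
   remains is a hyperbola with a factored equation. *)
Let factor w : w \in W ->
  (t * w.1.1.2 - w.2 * y) * (t * w.1.2 - w.2 * z) = disc w.2.
Proof.
move=> wW; move: (W_det wW) (W_lin wW); rewrite /qdet /qpair /disc /=.
by move: w.1.1.1 w.1.1.2 w.1.2 w.2 => a b c d <- <-; ring.
Qed.

Let mul_t_inj (u v : int) : t * u = t * v -> u = v.
Proof. exact: mulfI. Qed.

Let quad_eq (w w' : quad) : w \in W -> w' \in W -> w.2 = w'.2 ->
  w.1.1.2 = w'.1.1.2 -> w.1.2 = w'.1.2 -> w = w'.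
Proof.
move=> wW w'W; move: (W_lin wW) (W_lin w'W); rewrite /qpair /=.
case: w {wW} => [[[a b] c] d]; case: w' {w'W} => [[[a' b'] c'] d'] /= E1 E2 Ed Eb Ec.
subst d' b' c'; congr (_, _, _, _); apply: mul_t_inj.
by have := etrans E1 (esym E2); lia.
Qed.

Let size_slice k : (k <= R)%N ->
  (size [seq w <- W | w.2 == k%:Z] <= 2 * D + (disc k%:Z == 0) * (2 * R.+1))%N.
Proof.
move=> le_kR; set S := [seq w <- W | _].
have S_uniq : uniq S by rewrite filter_uniq.
have SW w : w \in S -> w \in W /\ w.2 = k%:Z by rewrite mem_filter => /andP[/eqP].
clearbody S.
(* If [disc] vanishes, so does one of the two factors: then b or c is determined, and the other
   ranges over at most R+1 values. Otherwise the first factor is a divisor of [disc] and determines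
   w. *)
have [m0|m0] := eqVneq (disc k%:Z) 0.
  pose S1 := [seq w <- S | t * w.1.1.2 == w.2 * y].
  pose S2 := [seq w <- S | t * w.1.1.2 != w.2 * y].
  have -> : size S = (size S1 + size S2)%N by rewrite [size S1]size_filter [size S2]size_filter (count_predC (fun w => t * w.1.1.2 == w.2 * y)).
  rewrite mul1n; apply: (@leq_trans (R.+1 + R.+1)); last by rewrite addnn -mul2n leq_addl.
  apply: leq_add.
    apply: (@size_le_interval _ _ (fun w => w.1.2)).
    - by rewrite filter_uniq.
    - move=> w w'; rewrite !mem_filter => /andP[/eqP E /SW[wW Ed]] /andP[/eqP E' /SW[w'W Ed']] Ec.
      apply: quad_eq => //; first by rewrite Ed Ed'.
      by apply: mul_t_inj; rewrite E E' Ed Ed'.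
    - by move=> w; rewrite mem_filter => /andP[_ /SW[/W_box /and4P[]]].
  apply: (@size_le_interval _ _ (fun w => w.1.1.2)).
  - by rewrite filter_uniq.
  - have zc w : w \in W -> w.2 = k%:Z -> t * w.1.1.2 != w.2 * y -> t * w.1.2 = w.2 * z.
      move=> wW Ed ne; have := factor wW; rewrite Ed m0 -Ed => /eqP.
      by rewrite mulf_eq0 !subr_eq0 (negbTE ne) /= => /eqP.
    move=> w w'; rewrite !mem_filter => /andP[ne /SW[wW Ed]] /andP[ne' /SW[w'W Ed']] Eb.
    apply: quad_eq => //; first by rewrite Ed Ed'.
    by apply: mul_t_inj; rewrite !zc // Ed Ed'.
  - by move=> w; rewrite mem_filter => /andP[_ /SW[/W_box /and4P[]]].
rewrite mul0n addn0.
apply: (@leq_trans (2 * size (divisors `|disc k%:Z|))); last by rewrite leq_mul2l HD.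
apply: (@size_le_divisors _ _ (fun w => t * w.1.1.2 - w.2 * y)) => //.
  move=> w w' /SW[wW Ed] /SW[w'W Ed']; rewrite Ed Ed' => /addIr /mul_t_inj Eb.
  apply: quad_eq => //; first by rewrite Ed Ed'.
  have Fw := factor wW; have Fw' := factor w'W.
  rewrite Ed in Fw; rewrite Ed' -Eb -Fw in Fw'.
  have u0 : t * w.1.1.2 - k%:Z * y != 0.
    by apply: contraNneq m0 => u0; rewrite -Fw u0 mul0r.
  by apply: mul_t_inj; move/(mulfI u0)/addIr: Fw'.
by move=> w /SW[wW Ed]; rewrite -Ed -(factor wW) dvdz_mulr.
Qed.

(** Slice by the fourth entry. A generic slice has at most 2D points. The degenerate slices are the
    roots of [disc], a polynomial of degree at most 2 whose constant term - e t^2 is nonzero, so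
    there are at most two of them, with at most 2(R+1) points each. *)
Lemma count_linear_section : (size W <= R.+1 * (2 * D) + 4 * R.+1)%N.
Proof.
rewrite (@size_fiber _ W (fun w => w.2) R); last by move=> w /W_box /and4P[].
apply: (@leq_trans (\sum_(k < R.+1) (2 * D + (disc k%:Z == 0) * (2 * R.+1)))).
  by apply: leq_sum => k _; apply: size_slice; rewrite -ltnS.
rewrite big_split /= sum_nat_const card_ord leq_add2l -big_distrl /=.
rewrite (_ : 4 = 2 * 2)%N // -mulnA leq_mul2r; apply/orP; right.
have -> : (\sum_(i < R.+1) (disc i%:Z == 0) =
           size [seq k <- iota 0 R.+1 | disc k%:Z == 0])%N.
  by rewrite size_filter -sum1_count [RHS]big_mkcond /= -(big_mkord xpredT (fun k => nat_of_bool (disc k%:Z == 0))) /index_iota subn0; apply: eq_bigr => k _; case: ifP.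
apply: (@size_quadratic_roots (y * z - t * x) (t * n) (- (e * t ^+ 2))).
- by rewrite oppr_eq0 mulf_neq0 // expf_neq0.
- by rewrite filter_uniq ?iota_uniq.
- by move=> k; rewrite mem_filter => /andP[/eqP].
Qed.

End Count.

(** The relation p K <= R absorbs the middle term: its size K (2 p K^2) R is 2 K^2 R (p K) <= 2 K^2
    R^2. *)
Lemma disc_bound (K R p : nat) (x y z t n e d : int) :
  (0 < K)%N -> (0 < p)%N -> (p * K <= R)%N ->
  `|x| <= K%:Z -> `|y| <= K%:Z -> `|z| <= K%:Z -> `|t| <= K%:Z ->
  `|n| <= (2 * p * K ^ 2)%N%:Z -> `|e| <= 1 -> 0 <= d <= R%:Z ->
  (`|((y * z - t * x) * d ^+ 2 + t * n * d + - (e * t ^+ 2))%R| <= 5 * (K ^ 2 * R ^ 2))%N.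
Proof.
move=> K0 p0 pK hx hy hz ht hn he hd; rewrite -lez_nat abszE.
have R0 : (0 < R)%N by apply: leq_trans pK; rewrite muln_gt0 p0.
have hd' : `|d| <= R%:Z by lia.
have M (u v : int) (A B : nat) : `|u| <= A%:Z -> `|v| <= B%:Z -> `|u * v| <= (A * B)%N%:Z.
  by move=> hu hv; rewrite normrM PoszM ler_pM.
have hyz := M _ _ _ _ hy hz; have htx := M _ _ _ _ ht hx.
have h1 : `|y * z - t * x| <= (2 * (K * K))%N%:Z.
  by apply: le_trans (ler_normB _ _) _; lia.
have h2 := M _ _ _ _ h1 (M _ _ _ _ hd' hd').
have h3 := M _ _ _ _ (M _ _ _ _ ht hn) hd'.
have h4 := M _ _ _ _ he (M _ _ _ _ ht ht).
have h5 : `|(y * z - t * x) * d ^+ 2 + t * n * d + - (e * t ^+ 2)| <=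
  (2 * (K * K) * (R * R) + K * (2 * p * K ^ 2) * R + 1 * (K * K))%N%:Z.
  rewrite !PoszD; apply: le_trans (ler_normD _ _) _; rewrite normrN !expr2 lerD //.
  by apply: le_trans (ler_normD _ _) _; rewrite lerD.
apply: le_trans h5 _; rewrite lez_nat.
have h6 : (K * (2 * p * K ^ 2) * R <= 2 * (K ^ 2 * R ^ 2))%N.
  rewrite (_ : K * (2 * p * K ^ 2) * R = 2 * (K ^ 2 * R) * (p * K))%N; last by ring.
  rewrite (_ : 2 * (K ^ 2 * R ^ 2) = 2 * (K ^ 2 * R) * R)%N; last by ring.
  by rewrite leq_mul2l pK orbT.
have h7 : (1 * (K * K) <= K ^ 2 * R ^ 2)%N by rewrite mul1n leq_pmulr // expn_gt0 R0.
have h8 : (2 * (K * K) * (R * R) = 2 * (K ^ 2 * R ^ 2))%N by ring.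
lia.
Qed.

Definition qbounded (K : nat) (V : quad) :=
  [&& `|V.1.1.1| <= K%:Z, `|V.1.1.2| <= K%:Z, `|V.1.2| <= K%:Z & `|V.2| <= K%:Z].

Lemma qdet_bound K V : qbounded K V -> `|qdet V| <= (2 * K ^ 2)%N%:Z.
Proof.
move=> /and4P[hx hy hz ht]; apply: le_trans (ler_normB _ _) _; rewrite !normrM.
rewrite (_ : (2 * K ^ 2)%N%:Z = K%:Z * K%:Z + K%:Z * K%:Z); last by rewrite -mulnn; lia.
by rewrite lerD // ler_pM.
Qed.

(** The linear relation is what det(w + pV) = det w becomes after division by p. Some entry of V is
    nonzero, and a permutation of the entries moves it to the fourth place, where
    [count_linear_section] applies; two of the permutations change the sign of the determinant,
    whence the parameter e = 1 or -1 there. *)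
Lemma count_displacement (K R D p : nat) (V : quad) (W : seq quad) :
  (0 < p)%N -> (p * K <= R)%N ->
  (forall n, (0 < n <= 5 * (K ^ 2 * R ^ 2))%N -> (size (divisors n) <= D)%N) ->
  qbounded K V -> V != (0, 0, 0, 0) -> uniq W ->
  (forall w, w \in W -> qbox R w) -> (forall w, w \in W -> qdet w = 1) ->
  (forall w, w \in W -> qpair V w = - (p%:Z * qdet V)) ->
  (size W <= R.+1 * (2 * D) + 4 * R.+1)%N.
Proof.
move=> p0 pK HD VK V0 W_uniq W_box W_det W_lin.
have hn : `|- (p%:Z * qdet V)| <= (2 * p * K ^ 2)%N%:Z.
  rewrite normrN normrM (_ : (2 * p * K ^ 2)%N%:Z = p%:Z * (2 * K ^ 2)%N%:Z); last by lia.
  by rewrite ler_pM // qdet_bound.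
have K0 : (0 < K)%N.
  rewrite lt0n; apply: contraNneq V0 => K0; move: VK; rewrite /qbounded K0 !normr_le0.
  by case: V {hn W_lin} => [[[? ?] ?] ?] /= /and4P[/eqP-> /eqP-> /eqP-> /eqP->].
have HD' x y z t n e (k : nat) : qbounded K (x, y, z, t) ->
    `|n| <= (2 * p * K ^ 2)%N%:Z -> `|e| <= 1 -> (k <= R)%N ->
    (y * z - t * x) * k%:Z ^+ 2 + t * n * k%:Z + - (e * t ^+ 2) != 0 ->
    (size (divisors `|((y * z - t * x) * k%:Z ^+ 2 + t * n * k%:Z + - (e * t ^+ 2))%R|) <= D)%N.
  move=> /and4P[/= hx hy hz ht] hn' he hk m0; apply: HD; rewrite absz_gt0 m0 /=.
  exact: (disc_bound K0 p0).
move: VK V0 W_lin hn; set n := - _; clearbody n; case: V => [[[x y] z] t] VK V0 W_lin hn.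
have /and4P[/= hx hy hz ht] := VK.
have e1 : `|1 : int| <= 1 by []. have eN1 : `|- 1 : int| <= 1 by [].
have [t0|t0] := eqVneq t 0; last first.
  apply: (@count_linear_section R D x y z t n 1 W) => // k hk.
  exact: HD'.
have [x0|x0] := eqVneq x 0; last first.
  pose g (w : quad) : quad := (w.2, w.1.1.2, w.1.2, w.1.1.1).
  have gK : involutive g by case=> [[[]]].
  rewrite -(size_map g); apply: (@count_linear_section R D t y z x n 1) => //.
  - by rewrite map_inj_uniq //; apply: inv_inj.
  - by move=> _ /mapP[w /W_box /and4P[h1 h2 h3 h4] ->]; apply/and4P; split.
  - by move=> _ /mapP[w /W_det h ->]; rewrite -h /qdet /=; ring.
  - by move=> _ /mapP[w /W_lin h ->]; rewrite -h /qpair /=; ring.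
  by move=> k hk; apply: HD' => //; apply/and4P.
have [z0|z0] := eqVneq z 0; last first.
  pose g (w : quad) : quad := (w.1.1.2, w.1.1.1, w.2, w.1.2).
  have gK : involutive g by case=> [[[]]].
  rewrite -(size_map g); apply: (@count_linear_section R D (- y) (- x) (- t) (- z) n (- 1)) => //.
  - by rewrite oppr_eq0.
  - by rewrite map_inj_uniq //; apply: inv_inj.
  - by move=> _ /mapP[w /W_box /and4P[h1 h2 h3 h4] ->]; apply/and4P; split.
  - by move=> _ /mapP[w /W_det h ->]; rewrite -h /qdet /=; ring.
  - by move=> _ /mapP[w /W_lin h ->]; rewrite -h /qpair /=; ring.
  by move=> k hk; apply: HD' => //; apply/and4P; rewrite /= !normrN.
have y0 : y != 0 by apply: contraNneq V0 => ->; rewrite x0 z0 t0.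
pose g (w : quad) : quad := (w.1.2, w.1.1.1, w.2, w.1.1.2).
pose g' (w : quad) : quad := (w.1.1.2, w.2, w.1.1.1, w.1.2).
have gK : cancel g g' by case=> [[[]]].
rewrite -(size_map g); apply: (@count_linear_section R D (- z) (- x) (- t) (- y) n (- 1)) => //.
- by rewrite oppr_eq0.
- by rewrite map_inj_uniq //; apply: can_inj gK.
- by move=> _ /mapP[w /W_box /and4P[h1 h2 h3 h4] ->]; apply/and4P; split.
- by move=> _ /mapP[w /W_det h ->]; rewrite -h /qdet /=; ring.
- by move=> _ /mapP[w /W_lin h ->]; rewrite -h /qpair /=; ring.
by move=> k hk; apply: HD' => //; apply/and4P; rewrite /= !normrN.
Qed.

(** * Pairs of matrices congruent modulo p *)

Definition qcong (p : nat) (w w' : quad) :=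
  [&& (p %| w'.1.1.1 - w.1.1.1)%Z, (p %| w'.1.1.2 - w.1.1.2)%Z,
      (p %| w'.1.2 - w.1.2)%Z & (p %| w'.2 - w.2)%Z].

Definition collisions (p : nat) (W : seq quad) :=
  (\sum_(w <- W) size [seq w' <- W | qcong p w w'])%N.

Definition qrange (K : nat) : seq int := [seq k%:Z - K%:Z | k <- iota 0 (2 * K).+1].

Lemma mem_qrange K i : (i \in qrange K) = (`|i| <= K%:Z).
Proof.
apply/mapP/idP => [[k]|hi]; first by rewrite mem_iota => hk ->; lia.
exists `|(i + K%:Z)%R|%N; last by move: (i : int) hi => j; lia.
by rewrite mem_iota; move: (i : int) hi => j; lia.
Qed.

Definition qball (K : nat) : seq quad :=
  [seq (v, t) | v <- [seq (v, z) | v <- [seq (x, y) | x <- qrange K, y <- qrange K],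
                                    z <- qrange K], t <- qrange K].

Lemma size_qball K : (size (qball K) = (2 * K).+1 ^ 4)%N.
Proof. by rewrite /qball !size_allpairs /qrange !size_map size_iota; ring. Qed.

Lemma mem_qball K V : (V \in qball K) = qbounded K V.
Proof.
apply/idP/idP.
  case/allpairsP => -[u t] [+ + ->]; rewrite [(u, t).1]/= [(u, t).2]/=.
  case/allpairsP => -[v z] [+ + ->]; rewrite [(v, z).1]/= [(v, z).2]/=.
  case/allpairsP => -[x y] [+ + ->]; rewrite [(x, y).1]/= [(x, y).2]/=.
  by rewrite !mem_qrange => h1 h2 h3 h4; apply/and4P.
case: V => [[[x y] z] t] /and4P[/= hx hy hz ht].
by do 3![apply: allpairs_f; rewrite ?mem_qrange //].
Qed.

(** Congruent matrices of the box differ by pV with the entries of V at most R/p in absolute value.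
    V = 0 gives the diagonal pairs, and each of the other V, at most (2K+1)^4 in number, is treated
    by [count_displacement]. *)
Lemma collisions_bound (R D p : nat) (W : seq quad) : (0 < p)%N ->
  let K := (R %/ p)%N in
  (forall n, (0 < n <= 5 * (K ^ 2 * R ^ 2))%N -> (size (divisors n) <= D)%N) ->
  uniq W -> (forall w, w \in W -> qbox R w) -> (forall w, w \in W -> qdet w = 1) ->
  (collisions p W <= size W + (2 * K).+1 ^ 4 * (R.+1 * (2 * D) + 4 * R.+1))%N.
Proof.
move=> p0 K HD W_uniq W_box W_det.
have pK : (p * K <= R)%N by rewrite mulnC leq_trunc_div.
pose ok V w := (V != (0, 0, 0, 0)) && (qpair V w == - (p%:Z * qdet V)).
have le_w w : w \in W -> (size [seq w' <- W | qcong p w w'] <=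
    1 + \sum_(V <- qball K) ok V w)%N.
  move=> wW.
  pose disp (w' : quad) : quad := (((w'.1.1.1 - w.1.1.1) %/ p)%Z, ((w'.1.1.2 - w.1.1.2) %/ p)%Z,
     ((w'.1.2 - w.1.2) %/ p)%Z, ((w'.2 - w.2) %/ p)%Z).
  have -> : (\sum_(V <- qball K) ok V w)%N = size [seq V <- qball K | ok V w].
    by rewrite size_filter -sum1_count [RHS]big_mkcond /=; apply: eq_bigr => V _; case: (ok V w).
  rewrite add1n -[X in (_ <= X)%N]/(size ((0, 0, 0, 0) :: [seq V <- qball K | ok V w])).
  rewrite -(size_map disp).
  have dispE w' : qcong p w w' -> w' = (w.1.1.1 + p%:Z * (disp w').1.1.1,
      w.1.1.2 + p%:Z * (disp w').1.1.2, w.1.2 + p%:Z * (disp w').1.2, w.2 + p%:Z * (disp w').2).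
    case: w' => [[[a b] c] d] /and4P[/= h1 h2 h3 h4].
    by rewrite !(mulrC p%:Z) !divzK //; congr (_, _, _, _); ring.
  apply: uniq_leq_size.
    rewrite map_inj_in_uniq ?filter_uniq // => w1 w2.
    by rewrite !mem_filter => /andP[/dispE E1 _] /andP[/dispE E2 _] E; rewrite E1 E -E2.
  move=> _ /mapP[w' + ->]; rewrite mem_filter => /andP[cw w'W].
  have E := dispE _ cw; move: (disp w') E => V E.
  rewrite inE; have [//|V0] := eqVneq V (0, 0, 0, 0); rewrite orFb mem_filter /ok V0 andTb.
  apply/andP; split.
    (* Here det(w + pV) = det w + p [qpair V w] + p^2 det V; both determinants are 1, and p
       cancels. *)
    apply/eqP; have := W_det w' w'W; rewrite -(W_det w wW) E /qdet /qpair /=.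
    have pz : p%:Z != 0 by lia.
    move=> H; apply: (mulfI pz); apply/eqP; rewrite -subr_eq0; move/eqP: H; rewrite -subr_eq0.
    by congr (_ == 0); ring.
  rewrite mem_qball; have /and4P[u1 u2 u3 u4] := W_box w wW; have /and4P[v1 v2 v3 v4] := W_box w' w'W.
  have B (s s' i : int) : 0 <= s <= R%:Z -> 0 <= s' <= R%:Z -> s' = s + p%:Z * i -> `|i| <= K%:Z.
    move=> hs hs' Es; have : `|p%:Z * i| <= R%:Z by lia.
    by rewrite normrM /= -abszE -PoszM !lez_nat leq_divRL // mulnC.
  rewrite E in v1 v2 v3 v4; apply/and4P; split.
  - exact: (B _ _ _ u1 v1 erefl).
  - exact: (B _ _ _ u2 v2 erefl).
  - exact: (B _ _ _ u3 v3 erefl).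
  - exact: (B _ _ _ u4 v4 erefl).
rewrite /collisions big_seq; apply: (@leq_trans (\sum_(w <- W | w \in W) (1 + \sum_(V <- qball K) ok V w))).
  exact: leq_sum.
rewrite -big_seq big_split /= sum1_size leq_add2l exchange_big /=.
rewrite -(size_qball K) -sum1_size big_distrl /= big_seq [X in (_ <= X)%N]big_seq.
apply: leq_sum => V VK; rewrite mul1n.
have -> : (\sum_(w <- W) ok V w)%N = size [seq w <- W | ok V w].
  by rewrite size_filter -sum1_count [RHS]big_mkcond /=; apply: eq_bigr => w _; case: (ok V w).
have [V0|V0] := eqVneq V (0, 0, 0, 0).
  by rewrite (eq_filter (a2 := pred0)) ?filter_pred0 // => w; rewrite /ok V0 eqxx.
apply: (@count_displacement K R D p V) => //.
- by rewrite -mem_qball.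
- exact: filter_uniq.
- by move=> w; rewrite mem_filter => /andP[_ /W_box].
- by move=> w; rewrite mem_filter => /andP[_ /W_det].
- by move=> w; rewrite mem_filter => /andP[/andP[_ /eqP]].
Qed.

(** * Words in U and L *)

(** Multiplication by U, and then by L, on the right, that is, as column operations. *)
Definition qmulU (w : quad) : quad := (w.1.1.1, w.1.1.1 + w.1.1.2, w.1.2, w.1.2 + w.2).
Definition qmulL (w : quad) : quad := (w.1.1.1 + w.1.1.2, w.1.1.2, w.1.2 + w.2, w.2).

Fixpoint words (m : nat) : seq quad :=
  if m is m'.+1 then map qmulU (words m') ++ map qmulL (words m') else [:: (1, 0, 0, 1)].

Definition qsum (w : quad) := w.1.1.1 + w.1.1.2 + w.1.2 + w.2.

Lemma size_words m : size (words m) = (2 ^ m)%N.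
Proof. by elim: m => //= m IHm; rewrite size_cat !size_map IHm addnn -mul2n expnS. Qed.

Lemma words_ge0 m w : w \in words m ->
  [/\ 0 <= w.1.1.1, 0 <= w.1.1.2, 0 <= w.1.2 & 0 <= w.2].
Proof.
elim: m w => [|m IHm] w; first by rewrite inE => /eqP ->.
by rewrite mem_cat => /orP[] /mapP[v /IHm[h1 h2 h3 h4] ->]; split; rewrite //= addr_ge0.
Qed.

Lemma words_det m w : w \in words m -> qdet w = 1.
Proof.
elim: m w => [|m IHm] w; first by rewrite inE => /eqP ->.
by rewrite mem_cat => /orP[] /mapP[v /IHm <- ->]; rewrite /qdet /=; ring.
Qed.

(** U and L generate a free monoid: if vL = uU with nonnegative entries, comparing columns shows
    that the first column of v vanishes, against det v = 1. *)
Lemma uniq_words m : uniq (words m).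
Proof.
elim: m => //= m IHm; rewrite cat_uniq; apply/and3P; split.
- rewrite map_inj_uniq // => -[[[a b] c] d] [[[a' b'] c'] d'] [] -> /addrI -> -> /addrI -> //.
- apply/hasPn => _ /mapP[v vm ->]; apply/negP => /mapP[u um].
  have [] := words_ge0 um; have [] := words_ge0 vm; have := words_det vm.
  case: u {um} => [[[a b] c] d]; case: v {vm} => [[[a' b'] c'] d'] /=.
  rewrite /qdet /= => hdet h1 h2 h3 h4 h1' h2' h3' h4' [Ea Eb Ec Ed].
  have a0 : a' = 0 by lia.
  have c0 : c' = 0 by lia.
  by rewrite a0 c0 mul0r mulr0 in hdet.
- rewrite map_inj_uniq // => -[[[a b] c] d] [[[a' b'] c'] d'] [Ea Eb Ec Ed].
  by rewrite Eb in Ea; rewrite Ed in Ec; rewrite (addIr _ Ea) (addIr _ Ec) Eb Ed.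
Qed.

(** The vector (1, 1) is an eigenvector of U + L = (2 1; 1 2) for the eigenvalue 3. *)
Lemma sum_words m : \sum_(w <- words m) qsum w = 2 * 3 ^+ m.
Proof.
elim: m => [|m IHm]; first by rewrite big_seq1.
rewrite [words _]/= big_cat !big_map /= -big_split /= exprS mulrCA -IHm big_distrr /=.
by apply: eq_bigr => -[[[a b] c] d] _; rewrite /qsum /=; ring.
Qed.

Definition short_words (m R : nat) := [seq w <- words m | qsum w <= R%:Z].
Definition long_words (m R : nat) := [seq w <- words m | ~~ (qsum w <= R%:Z)].

Lemma short_words_box m R w : w \in short_words m R -> qbox R w.
Proof.
rewrite mem_filter => /andP[+ /words_ge0[a1 a2 a3 a4]]; rewrite /qsum /qbox.
by case: w a1 a2 a3 a4 => [[[a b] c] d] /=; lia.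
Qed.

(** Markov's inequality, from the total computed in [sum_words]. *)
Lemma count_long_words m R :
  (R * size (long_words m R) <= 2 * 3 ^ m)%N.
Proof.
rewrite -lez_nat.
have -> : (2 * 3 ^ m)%N%:Z = 2 * 3 ^+ m by rewrite PoszM; congr (_ * _); rewrite -natz natrX.
rewrite -sum_words mulnC PoszM -natz size_filter -sum1_count natr_sum big_distrl /=.
rewrite big_mkcond /= big_seq [leRHS]big_seq; apply: ler_sum => w /words_ge0[h1 h2 h3 h4].
by rewrite /qsum; case: ifP => h; [rewrite mul1r ltW // ltNge|rewrite !addr_ge0].
Qed.

Lemma expn3_17_le_expn2_27 : (3 ^ 17 <= 2 ^ 27)%N.
Proof.
have -> : (3 ^ 17 = 3 * ((3 ^ 4 * 3 ^ 4) * (3 ^ 4 * 3 ^ 4)))%N by ring.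
have -> : (2 ^ 27 = 2 ^ 9 * (2 ^ 9 * 2 ^ 9))%N by rewrite -!expnD.
by have -> : (3 ^ 4 = 81)%N by []; have -> : (2 ^ 9 = 512)%N by []; lia.
Qed.

(* 3 ^ 17 <= 2 ^ 27 says that 2 >= (3/2) ^ (17/10), and 204 = 120 * 17 / 10. *)
Lemma word_count_large y m : (2 ^ m * y ^ 120 <= 3 ^ m)%N -> (y ^ 204 <= 2 ^ m)%N.
Proof.
have mono a b : (a <= b)%N -> (a ^ m <= b ^ m)%N.
  by move=> le_ab; case: (m) => // k; rewrite leq_exp2r.
move=> h; rewrite -(@leq_exp2r _ _ 10) // -!expnM.
have h17 : ((2 ^ m * y ^ 120) ^ 17 <= (3 ^ m) ^ 17)%N by rewrite leq_exp2r.
rewrite -(@leq_pmul2l (2 ^ (m * 17))%N) ?expn_gt0 //.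
have -> : (2 ^ (m * 17) * y ^ (204 * 10) = (2 ^ m * y ^ 120) ^ 17)%N.
  by rewrite expnMn -!expnM.
have -> : (2 ^ (m * 17) * 2 ^ (m * 10) = (2 ^ 27) ^ m)%N.
  by rewrite -expnD -mulnDr -expnM mulnC.
apply: leq_trans h17 _; rewrite (_ : (3 ^ m) ^ 17 = (3 ^ 17) ^ m)%N; last by rewrite -!expnM mulnC.
exact: mono expn3_17_le_expn2_27.
Qed.

Lemma exists_word_length y : (0 < y)%N -> exists m,
  (2 ^ m * y ^ 120 <= 3 ^ m)%N /\ (3 ^ m <= 2 * (2 ^ m * y ^ 120))%N.
Proof.
move=> y0; pose P m := (2 ^ m * y ^ 120 <= 3 ^ m)%N.
have exP : exists m, P m.
  (* With j = y^120 and m = 2j: 9^j >= 4^j 2^j >= 4^j j. *)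
  exists (2 * y ^ 120)%N; rewrite /P expnM [(3 ^ _)%N]expnM.
  set j := (y ^ 120)%N; apply: (@leq_trans ((2 ^ 2) ^ j * 2 ^ j)).
    by rewrite leq_mul2l ltnW ?orbT // ltn_expl.
  by rewrite -expnMn; case: (j) => // k; rewrite leq_exp2r.
case: (ex_minnP exP) => m Pm m_min; exists m; split => //.
case: m Pm m_min => [|m] Pm m_min; first by rewrite !expn0 mul1n muln_gt0 expn_gt0 y0.
have [/m_min|] := boolP (P m); first by rewrite ltnn.
rewrite /P -ltnNge => lt3; rewrite [(3 ^ _)%N]expnS [(2 ^ m.+1)%N]expnS -mulnA; move: lt3.
by move: (2 ^ m * _)%N (3 ^ m)%N => u v; lia.
Qed.

(* With p ~ y ^ 100, the length m is such that (3/2) ^ m ~ p ^ (6/5), and the words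
   whose entries exceed R = 3 y ^ 121 are discarded. *)
Lemma word_statistics : exists C, forall y p, (0 < y)%N -> (y ^ 100 <= p <= (2 * y) ^ 100)%N ->
  exists m R, [/\ (3 ^ m <= 2 * (2 ^ m * y ^ 120))%N,
    (y * size (long_words m R) <= 2 * 2 ^ m)%N &
    (collisions p (short_words m R) * p ^ 2 * y ^ 2 <= C * 4 ^ m)%N].
Proof.
have aux1 k u : (k <= 3 * u)%N -> (0 < u)%N -> ((2 * k).+1 <= 7 * u)%N by lia.
have aux2 u : (0 < u)%N -> ((3 * u).+1 <= 4 * u)%N by lia.
have aux3 u : (0 < u)%N -> (2 * u + 4 <= 6 * u)%N by lia.
have aux4 x c v a u w : ((x + c * v) * (a * u) * w =
    a * (x * (u * w)) + c * a * (v * (u * w)))%N by ring.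
have aux5 a b c d e : (a * b * (4 * c * (6 * d * e)) =
    a * (4 * (6 * d)) * (b * c * e))%N by ring.
(* The numbers to be factored are at most 5 K^2 R^2 with K <= 3 y^21 and R = 3 y^121, hence
   O(y^284); the exponent 300 makes their number of divisors O(y). *)
have [B HB] := divisor_bound 300.
pose B' := (405 * B).+1.
have [A HA] : exists A, forall y, (((2 * y) ^ 100) ^ 2 <= A * y ^ 200)%N.
  by exists ((2 ^ 100) ^ 2)%N => y; rewrite -[200%N]/(100 * 2)%N expnM -expnMn expnMn.
exists (A + 7 ^ 4 * (4 * (6 * B')) * A)%N => y p y0 /andP[yp py].
have p0 : (0 < p)%N by apply: leq_trans yp; rewrite expn_gt0 y0.
have [m [h1 h2]] := exists_word_length y0.
pose R := (3 * y ^ 121)%N; exists m, R; split => //.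
  have := count_long_words m R; set s := size _ => hs.
  have y120 : (0 < y ^ 120)%N by rewrite expn_gt0 y0.
  rewrite -(@leq_pmul2l (y ^ 120)%N) // mulnA -expnSr.
  rewrite /R in hs; move: (y ^ 121 * s)%N (mulnA 3 (y ^ 121)%N s) hs => u <- {}hs.
  by clear h1; move: (y ^ 120)%N (2 ^ m)%N (3 ^ m)%N h2 hs => Y T T3; clear; lia.
have h204 := word_count_large h1.
pose K := (R %/ p)%N.
have K_le : (K <= 3 * y ^ 21)%N.
  apply: (@leq_trans (R %/ y ^ 100)); first by rewrite leq_div2l // expn_gt0 y0.
  by rewrite /R -[121%N]/(21 + 100)%N expnD mulnA mulnK // expn_gt0 y0.
have R_gt0 : (0 < y ^ 121)%N by rewrite expn_gt0 y0.
have HD n : (0 < n <= 5 * (K ^ 2 * R ^ 2))%N -> (size (divisors n) <= B' * y)%N.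
  case/andP=> n0 nle; rewrite -(@leq_exp2r _ _ 300) //.
  apply: leq_trans (HB n n0) _; apply: (@leq_trans (B' * y ^ 300)); last first.
    by rewrite expnMn leq_mul2r -[leqLHS]expn1 leq_pexp2l ?orbT.
  apply: (@leq_trans (B * (5 * ((3 * y ^ 21) ^ 2 * R ^ 2)))).
    by rewrite leq_mul2l (leq_trans nle) ?orbT // leq_mul2l leq_mul2r leq_exp2r // K_le !orbT.
  have -> : (B * (5 * ((3 * y ^ 21) ^ 2 * R ^ 2)) = 405 * B * y ^ 284)%N.
    by rewrite /R; ring.
  by rewrite leq_mul ?leqnSn // leq_pexp2l.
have coll := @collisions_bound R (B' * y) p (short_words m R) p0 HD
  (filter_uniq _ (uniq_words m)) (@short_words_box m R).
have {}coll := coll (fun w hw => @words_det m w (mem_subseq (filter_subseq _ _) hw)).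
rewrite -/K in coll.
have hW : (size (short_words m R) <= 2 ^ m)%N by rewrite -size_words size_filter count_size.
have hp : (p ^ 2 <= A * y ^ 200)%N.
  by apply: leq_trans (HA y); rewrite leq_exp2r.
have hbox : ((2 * K).+1 ^ 4 * (R.+1 * (2 * (B' * y)) + 4 * R.+1) <=
             7 ^ 4 * (4 * (6 * B')) * y ^ 206)%N.
  have b1 : ((2 * K).+1 <= 7 * y ^ 21)%N by rewrite aux1 // expn_gt0 y0.
  have b2 : (R.+1 <= 4 * y ^ 121)%N by apply: aux2.
  have b3 : (2 * (B' * y) + 4 <= 6 * B' * y)%N by rewrite -mulnA aux3 // muln_gt0.
  have -> : (R.+1 * (2 * (B' * y)) + 4 * R.+1 = R.+1 * (2 * (B' * y) + 4))%N by ring.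
  apply: (@leq_trans ((7 * y ^ 21) ^ 4 * (4 * y ^ 121 * (6 * B' * y)))).
    by rewrite leq_mul ?leq_exp2r // leq_mul.
  rewrite -[206%N]/(21 * 4 + 121 + 1)%N !expnD expnMn -expnM expn1.
  by rewrite aux5.
have e4 : (4 ^ m = 2 ^ m * 2 ^ m)%N by rewrite -expnMn.
apply: (@leq_trans ((2 ^ m + 7 ^ 4 * (4 * (6 * B')) * y ^ 206) * (A * y ^ 200) * y ^ 2)).
  rewrite leq_mul2r; apply/orP; right; apply: leq_mul => //.
  exact: leq_trans coll (leq_add hW hbox).
(* Since 2^m >= y^204, both contributions, multiplied by p^2 y^2 = O(y^202), are O(4^m): the
   diagonal 2^m, and the off-diagonal part K^4 R D = O(y^206), because 206 + 202 = 2 * 204. *)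
have z1 : (y ^ 200 * y ^ 2 <= 2 ^ m)%N.
  by apply: leq_trans h204; rewrite -expnD leq_pexp2l.
have z2 : (y ^ 206 * (y ^ 200 * y ^ 2) <= 4 ^ m)%N.
  rewrite e4 (_ : y ^ 206 * _ = y ^ 204 * y ^ 204)%N; last by rewrite -!expnD.
  exact: leq_mul.
rewrite aux4 mulnDl leq_add // leq_mul2l ?z2 ?orbT //.
by rewrite e4 leq_mul2l z1 !orbT.
Qed.

(** * Inner products *)

Section InnerProduct.
Variables (T : finType) (R : realType).
Implicit Types f g h : {ffun T -> R^o}.

Definition ip f g : R := \sum_v f v * g v.
Definition nm f : R := Num.sqrt (ip f f).

Lemma ipC f g : ip f g = ip g f.
Proof. by apply: eq_bigr => v _; rewrite mulrC. Qed.

Lemma ipDl f g h : ip (f + g) h = ip f h + ip g h.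
Proof. by rewrite -big_split; apply: eq_bigr => v _; rewrite ffunE mulrDl. Qed.

Lemma ipZl a f h : ip (a *: f) h = a * ip f h.
Proof. by rewrite mulr_sumr; apply: eq_bigr => v _; rewrite ffunE /= mulrA. Qed.

Lemma ipNl f h : ip (- f) h = - ip f h.
Proof. by rewrite -scaleN1r ipZl mulN1r. Qed.

Lemma ipDr f g h : ip h (f + g) = ip h f + ip h g.
Proof. by rewrite ipC ipDl !(ipC h). Qed.

Lemma ipZr a f h : ip h (a *: f) = a * ip h f.
Proof. by rewrite ipC ipZl (ipC h). Qed.

Lemma ipNr f h : ip h (- f) = - ip h f.
Proof. by rewrite ipC ipNl (ipC h). Qed.

Lemma ip0l h : ip 0 h = 0.
Proof. by rewrite -(scale0r 0) ipZl mul0r. Qed.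

Lemma ip_suml (I : Type) (s : seq I) (G : I -> {ffun T -> R^o}) h :
  ip (\sum_(i <- s) G i) h = \sum_(i <- s) ip (G i) h.
Proof.
elim/big_ind2: _ => //; first exact: ip0l.
by move=> x y z t <- <-; rewrite ipDl.
Qed.

Definition ipE := (ipDl, ipDr, ipNl, ipNr, ipZl, ipZr).

Lemma ip_ge0 f : 0 <= ip f f.
Proof. by apply: sumr_ge0 => v _; rewrite -expr2 sqr_ge0. Qed.

Lemma ip_eq0 f : (ip f f == 0) = (f == 0).
Proof.
apply/idP/eqP => [|->]; last by rewrite ip0l.
rewrite psumr_eq0 => [/allP f0|v _]; last by rewrite -expr2 sqr_ge0.
apply/ffunP => v; have := f0 v; rewrite mem_index_enum => /(_ isT).
by rewrite mulf_eq0 orbb ffunE => /eqP.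
Qed.

(** The discriminant argument, with positivity assumed only along the line f + a g. This allows its
    use both for [ip] and, in [two_projections], for a form that is known to be nonnegative only on
    invariant functions. *)
Lemma cauchy_schwarz_form (B : {ffun T -> R^o} -> {ffun T -> R^o} -> R) f g :
  (forall a : R, 0 <= B f f + 2 * a * B f g + a ^+ 2 * B g g) ->
  B f g ^+ 2 <= B f f * B g g.
Proof.
move=> pos; set x := B f f in pos *; set y := B f g in pos *; set z := B g g in pos *.
have [z0|z0] := eqVneq z 0.
  rewrite z0 mulr0 in pos *; rewrite real_exprn_even_le0 ?num_real //=.
  apply/eqP/eqP; apply: contraT => y0.
  (* This value makes the affine function x + 2 a y equal to -1. *)
  have := pos (- (x + 1) / (2 * y)); rewrite mulr0 addr0.
  rewrite (_ : 2 * (- (x + 1) / (2 * y)) * y = - (x + 1)); last by field.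
  lra.
have x0 : 0 <= x by have := pos 0; rewrite expr0n /= mul0r mulr0 mul0r !addr0.
have z_gt0 : 0 < z.
  rewrite lt0r z0 /= leNgt; apply/negP => zn.
  pose a := (x + 1 + `|2 * y|) / - z + 1.
  have az : a * z = - (x + 1 + `|2 * y|) + z by rewrite /a; field.
  have a1 : 1 <= a.
    rewrite lerDr mulr_ge0 ?invr_ge0 ?oppr_ge0 ?(ltW zn) //.
    by rewrite !addr_ge0.
  have := pos a; rewrite (_ : a ^+ 2 * z = a * (a * z)); last by ring.
  rewrite az.
  have : 2 * a * y <= a * `|2 * y| by rewrite -mulrA mulrCA ler_wpM2l ?ler_norm // (le_trans _ a1).
  nra.
have := pos (- y / z).
rewrite (_ : x + _ + _ = (x * z - y ^+ 2) / z); last by field.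
by rewrite pmulr_lge0 ?invr_gt0 // subr_ge0.
Qed.

Lemma cauchy_schwarz f g : ip f g ^+ 2 <= ip f f * ip g g.
Proof.
apply: cauchy_schwarz_form => a.
have := ip_ge0 (f + a *: g); rewrite !ipE (ipC g f).
by congr (_ <= _); ring.
Qed.

Lemma nm_ge0 f : 0 <= nm f. Proof. exact: sqrtr_ge0. Qed.

Lemma sqr_nm f : nm f ^+ 2 = ip f f.
Proof. by rewrite sqr_sqrtr // ip_ge0. Qed.

Lemma nm_eq0 f : (nm f == 0) = (f == 0).
Proof. by rewrite -ip_eq0 -sqr_nm sqrf_eq0. Qed.

Lemma nm_gt0 f : (0 < nm f) = (f != 0).
Proof. by rewrite lt0r nm_ge0 andbT nm_eq0. Qed.

Lemma nmZ a f : nm (a *: f) = `|a| * nm f.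
Proof. by rewrite /nm !ipE mulrA -expr2 sqrtrM ?sqr_ge0 // sqrtr_sqr. Qed.

Lemma nmN f : nm (- f) = nm f.
Proof. by rewrite -scaleN1r nmZ normrN normr1 mul1r. Qed.

Lemma nm0 : nm 0 = 0.
Proof. by apply/eqP; rewrite nm_eq0. Qed.

Lemma ip_le_nm f g : ip f g <= nm f * nm g.
Proof.
apply: le_trans (ler_norm _) _.
rewrite -ler_sqr ?nnegrE ?mulr_ge0 ?nm_ge0 // real_normK ?num_real //.
by rewrite exprMn !sqr_nm cauchy_schwarz.
Qed.

Lemma nmD f g : nm (f + g) <= nm f + nm g.
Proof.
rewrite -ler_sqr ?nnegrE ?addr_ge0 ?nm_ge0 //.
rewrite sqr_nm !ipE (ipC g f) sqrrD !sqr_nm; have := ip_le_nm f g; lra.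
Qed.

Lemma nmB f g : nm (f - g) <= nm f + nm g.
Proof. by rewrite -(nmN g) nmD. Qed.

Lemma nm_dist f g h : nm (f - h) <= nm (f - g) + nm (g - h).
Proof. by apply: le_trans (nmD _ _); rewrite addrA subrK. Qed.

Lemma nm_distC f g : nm (f - g) = nm (g - f).
Proof. by rewrite -nmN opprB. Qed.

Lemma nm_sum (I : Type) (s : seq I) (G : I -> {ffun T -> R^o}) :
  nm (\sum_(i <- s) G i) <= \sum_(i <- s) nm (G i).
Proof.
elim/big_ind2: _ => [|a b c d h1 h2|i _]; rewrite ?nm0 //.
by apply: le_trans (nmD _ _) (lerD _ _).
Qed.

End InnerProduct.

(** * Functions on the projective line *)

Section Plane.
Variable F : finFieldType.
Notation V := (F * F)%type.
Notation M := (F * F * F * F)%type.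

Definition mact (g : M) (v : V) : V :=
  (g.1.1.1 * v.1 + g.1.1.2 * v.2, g.1.2 * v.1 + g.2 * v.2).
Definition mdet (g : M) := g.1.1.1 * g.2 - g.1.1.2 * g.1.2.
Definition mmul (g h : M) : M :=
  (g.1.1.1 * h.1.1.1 + g.1.1.2 * h.1.2, g.1.1.1 * h.1.1.2 + g.1.1.2 * h.2,
   g.1.2 * h.1.1.1 + g.2 * h.1.2, g.1.2 * h.1.1.2 + g.2 * h.2).
Definition vscale (c : F) (v : V) : V := (c * v.1, c * v.2).
Definition vdet (v w : V) := v.1 * w.2 - v.2 * w.1.

Lemma mactM g h v : mact (mmul g h) v = mact g (mact h v).
Proof. by congr (_, _); rewrite /=; ring. Qed.

Lemma mact_scale g c v : mact g (vscale c v) = vscale c (mact g v).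
Proof. by congr (_, _); rewrite /=; ring. Qed.

Lemma mact0 g : mact g 0 = 0.
Proof. by congr (_, _); rewrite /= !mulr0 addr0. Qed.

Lemma vdet_mact g v w : vdet (mact g v) (mact g w) = mdet g * vdet v w.
Proof. by rewrite /vdet /mdet /=; ring. Qed.

Lemma vdet_eq0P (v w : V) : v != 0 -> vdet v w = 0 -> exists c, w = vscale c v.
Proof.
case: v w => [v1 v2] [w1 w2]; rewrite xpair_eqE negb_and /vdet /= => v0 /eqP.
rewrite subr_eq0 => /eqP E; have [v10|v10] := eqVneq v1 0.
  move: v0 E; rewrite v10 eqxx /= mul0r => v20 /esym /eqP; rewrite mulf_eq0 (negbTE v20) => /eqP ->.
  by exists (w2 / v2); rewrite /vscale /= mulr0 divfK.
exists (w1 / v1); rewrite /vscale /= divfK //; congr (_, _).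
by apply: (mulfI v10); rewrite E; field.
Qed.

Lemma mact_bij g : mdet g != 0 -> bijective (mact g).
Proof.
move=> g0; pose h : M := (g.2 / mdet g, - g.1.1.2 / mdet g, - g.1.2 / mdet g, g.1.1.1 / mdet g).
by exists (mact h) => -[v1 v2]; congr (_, _); rewrite /h /=; move: g0; rewrite /mdet;
  case: g {h} => [[[a b] c] d] /= g0; field.
Qed.

Section Functions.
Variable R : realType.
Notation fn := {ffun V -> R^o}.
Implicit Types f h : fn.

Definition pull g f : fn := [ffun v => f (mact g v)].

Lemma pullD g f h : pull g (f + h) = pull g f + pull g h.
Proof. by apply/ffunP => v; rewrite !ffunE. Qed.
Lemma pullZ g a f : pull g (a *: f) = a *: pull g f.
Proof. by apply/ffunP => v; rewrite !ffunE. Qed.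
Lemma pullN g f : pull g (- f) = - pull g f.
Proof. by apply/ffunP => v; rewrite !ffunE. Qed.
Lemma pullM g (h : M) f : pull g (pull h f) = pull (mmul h g) f.
Proof. by apply/ffunP => v; rewrite !ffunE mactM. Qed.
Definition pullE := (pullD, pullN, pullZ).

Lemma ip_pull g f h : mdet g != 0 -> ip (pull g f) (pull g h) = ip f h.
Proof.
move=> /mact_bij g_bij; rewrite [RHS](reindex (mact g)) /=; last exact: onW_bij.
by apply: eq_bigr => v _; rewrite !ffunE.
Qed.

Lemma nm_pull g f : mdet g != 0 -> nm (pull g f) = nm f.
Proof. by move=> g0; rewrite /nm ip_pull. Qed.

(* Mean-zero functions on the projective line, encoded by their lifts to the plane. *)
Definition hom0 f := [/\ f 0 = 0, forall c v, c != 0 -> f (vscale c v) = f v & \sum_v f v = 0].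

Lemma hom0D f h : hom0 f -> hom0 h -> hom0 (f + h).
Proof.
move=> [f1 f2 f3] [h1 h2 h3]; split; first by rewrite ffunE f1 h1 addr0.
  by move=> c v c0; rewrite !ffunE f2 ?h2.
by under eq_bigr do rewrite ffunE; rewrite big_split /= f3 h3 addr0.
Qed.

Lemma hom0Z a f : hom0 f -> hom0 (a *: f).
Proof.
move=> [f1 f2 f3]; split; first by rewrite ffunE f1 scaler0.
  by move=> c v c0; rewrite !ffunE f2.
by under eq_bigr do rewrite ffunE; rewrite -scaler_sumr f3 scaler0.
Qed.

Lemma hom0N f : hom0 f -> hom0 (- f).
Proof. by rewrite -scaleN1r; apply: hom0Z. Qed.

Lemma hom0_0 : hom0 0.
Proof. by split=> [|c v _|]; rewrite ?ffunE // big1 // => v _; rewrite ffunE. Qed.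

Lemma hom0_pull g f : mdet g != 0 -> hom0 f -> hom0 (pull g f).
Proof.
move=> g0 [f1 f2 f3]; split; first by rewrite ffunE mact0.
  by move=> c v c0; rewrite !ffunE mact_scale f2.
rewrite -[RHS]f3 [RHS](reindex (mact g)) /=; last exact: onW_bij (mact_bij g0).
by apply: eq_bigr => v _; rewrite ffunE.
Qed.

Lemma hom0_sum (I : eqType) (s : seq I) (G : I -> fn) :
  (forall i, i \in s -> hom0 (G i)) -> hom0 (\sum_(i <- s) G i).
Proof.
move=> hG; rewrite big_seq; elim/big_ind: _ => //; first exact: hom0_0.
exact: hom0D.
Qed.

Lemma pull_scalar c f : c != 0 -> hom0 f -> pull (c, 0, 0, c) f = f.
Proof.
move=> c0 [_ f2 _]; apply/ffunP => v; rewrite ffunE -(f2 c v c0).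
by congr (f (_, _)) => /=; rewrite mul0r ?addr0 ?add0r.
Qed.

(** The vectors w and u form a basis of determinant 1, and the affine line det(w, v) = d consists of
    the v = c w + d u. *)
Lemma sum_vdet (phi : V -> R) (w : V) : w != 0 -> exists2 u, vdet w u = 1 &
  forall d, \sum_(v | vdet w v == d) phi v =
    \sum_c phi (c * w.1 + d * u.1, c * w.2 + d * u.2).
Proof.
move=> w0; have [u u1] : exists u, vdet w u = 1.
  case: w w0 => [w1 w2]; rewrite xpair_eqE negb_and /vdet /= => w0.
  have [w10|w10] := eqVneq w1 0.
    by move: w0; rewrite w10 eqxx /= => w20; exists (- w2^-1, 0) => /=; field.
  by exists (0, w1^-1) => /=; field.
exists u => // d; pose k c : V := (c * w.1 + d * u.1, c * w.2 + d * u.2).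
pose k' (v : V) := vdet v u.
have kK c : k' (k c) = c.
  by rewrite -[RHS]mulr1 -u1 /k' /k /vdet /=; ring.
have k'K v : vdet w v = d -> k (k' v) = v.
  case: v => [v1 v2] E; rewrite /k /k' -E; case: w u u1 {w0 k k' kK E} => [w1 w2] [u1 u2].
  rewrite /vdet /= => E; rewrite -[RHS](_ : vscale 1 (v1, v2) = (v1, v2)); last by rewrite /vscale /= !mul1r.
  by rewrite -E /vscale /=; congr (_, _); ring.
rewrite (reindex_onto k k') /=; last by move=> v /eqP /k'K.
apply: eq_bigl => c; rewrite kK eqxx andbT -[RHS](eqxx d); congr (_ == _).
by rewrite -[RHS]mulr1 -u1 /k /vdet /=; ring.
Qed.

Lemma sum_line f v : hom0 f -> v != 0 ->
  \sum_(w | vdet v w == 0) f w = (#|F|.-1)%:R * f v.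
Proof.
move=> [f1 f2 _] v0; have [u _ ->] := sum_vdet f v0.
rewrite (bigD1 0) //= !mul0r !addr0 f1 add0r.
under eq_bigr => c c0 do rewrite !addr0 -/(vscale c v) f2 //.
rewrite sumr_const mulr_natl; congr (_ *+ _).
by rewrite -(cardC1 (0 : F)).
Qed.

Definition detsum f (d : F) := \sum_(p : V * V | vdet p.1 p.2 == d) f p.1 * f p.2.

Lemma detsum_const f d d' : hom0 f -> d != 0 -> d' != 0 -> detsum f d = detsum f d'.
Proof.
move=> [_ f2 _] d0 d0'; rewrite /detsum.
have dd0 : d / d' != 0 by rewrite mulf_neq0 ?invr_eq0.
rewrite (reindex (fun p : V * V => (p.1, vscale (d / d') p.2))) /=.
  apply: eq_big => p; last by rewrite f2.
  have -> : vdet p.1 (vscale (d / d') p.2) = d / d' * vdet p.1 p.2 by rewrite /vdet /=; ring.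
  by rewrite -[RHS](inj_eq (mulfI dd0)) divfK.
exists (fun p : V * V => (p.1, vscale (d' / d) p.2)) => -[v [w1 w2]] _;
  by rewrite /vscale /=; congr (_, (_, _)); field; rewrite d0 d0'.
Qed.

Lemma card_gt1 : (1 < #|F|)%N.
Proof. by apply/card_gt1P; exists 0, 1; rewrite ?inE ?[0 == 1]eq_sym ?oner_eq0. Qed.

(** Summed over all d, these sums give the square of the sum of f, which is 0. The term d = 0 is
    (q-1) times [ip f f] by [sum_line], and the q-1 other terms are equal by homogeneity. *)
Lemma detsumE f d : hom0 f -> d != 0 -> detsum f d = - ip f f.
Proof.
move=> hf d0; have [f1 f2 f3] := hf.
have q1 : (#|F|.-1)%:R != 0 :> R by rewrite pnatr_eq0 -lt0n -ltnS prednK ?card_gt1 // ltnW // card_gt1.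
have tot : \sum_(d : F) detsum f d = 0.
  transitivity (\sum_(p : V * V) f p.1 * f p.2).
    by rewrite [RHS](partition_big (fun p : V * V => vdet p.1 p.2) xpredT).
  by rewrite -(pair_bigA _ (fun v w => f v * f w)) /= big1 // => v _; rewrite -mulr_sumr f3 mulr0.
have zero : detsum f 0 = (#|F|.-1)%:R * ip f f.
  rewrite /detsum -(pair_big_dep xpredT (fun v w => vdet v w == 0) (fun v w => f v * f w)) /=.
  rewrite mulr_sumr; apply: eq_bigr => v _; rewrite -mulr_sumr.
  have [->|v0] := eqVneq v 0; first by rewrite f1 !mul0r mulr0.
  by rewrite (sum_line hf v0) mulrCA.
move: tot; rewrite (bigD1 0) //= zero.
rewrite (eq_bigr (fun=> detsum f d)); last by move=> c c0; apply: detsum_const.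
rewrite sumr_const cardC1 -[X in _ + X]mulr_natl -mulrDr => /eqP.
by rewrite mulf_eq0 (negbTE q1) addrC addr_eq0 => /eqP.
Qed.

End Functions.
End Plane.

(** * Schur orthogonality *)

Section Schur.
Variables (F : finFieldType) (R : realType).
Notation V := (F * F)%type.
Notation M := (F * F * F * F)%type.
Notation fn := {ffun V -> R^o}.
Implicit Types f h : fn.

(** SL_2 acts simply transitively on the pairs of vectors of a given nonzero determinant; [k]
    recovers g from the images of v and u by Cramer's rule. *)
Lemma reindex_sl2 (phi : V -> V -> R) (v u : V) : vdet v u != 0 ->
  \sum_(g : M | mdet g == 1) phi (mact g v) (mact g u) =
  \sum_(p : V * V | vdet p.1 p.2 == vdet v u) phi p.1 p.2.
Proof.
move=> vu0; pose k (p : V * V) : M :=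
  ((p.1.1 * u.2 - p.2.1 * v.2) / vdet v u, (p.2.1 * v.1 - p.1.1 * u.1) / vdet v u,
   (p.1.2 * u.2 - p.2.2 * v.2) / vdet v u, (p.2.2 * v.1 - p.1.2 * u.1) / vdet v u).
pose k' (g : M) := (mact g v, mact g u).
have k'K g : k (k' g) = g.
  case: g => [[[a b] c] d]; case: v u vu0 @k @k' => [v1 v2] [u1 u2]; rewrite /vdet /= => vu0.
  by rewrite /mact /=; congr (_, _, _, _); field.
have kK p : k' (k p) = p.
  clear k'K; case: p => [[a b] [c d]]; case: v u vu0 @k @k' => [v1 v2] [u1 u2]; rewrite /vdet /= => vu0.
  by rewrite /mact /=; congr (_, _, (_, _)); field.
rewrite (reindex_onto k k') /=; last by move=> g _; apply: k'K.
apply: eq_big => p; last by rewrite -[in RHS](kK p).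
rewrite kK eqxx andbT -[in RHS](kK p) /= vdet_mact -[in RHS](inj_eq (mulIf (invr_neq0 vu0))).
by rewrite mulfK // mulfV.
Qed.

Definition corr f (v u : V) := \sum_(g : M | mdet g == 1) f (mact g v) * f (mact g u).

(** For independent v and u this is [detsumE]. For proportional ones f takes equal values at gv and
    gu, and each nonzero vector is gv for exactly q elements g, which gives q [ip f f]. *)
Lemma corrE f (v u : V) : hom0 f -> v != 0 -> u != 0 ->
  corr f v u = - ip f f + (vdet v u == 0)%:R * ((#|F|%:R + 1) * ip f f).
Proof.
move=> hf v0 u0; have [vu0|vu0] := eqVneq (vdet v u) 0; last first.
  by rewrite mul0r addr0 /corr (reindex_sl2 (fun a b => f a * f b) vu0) -/(detsum f _) detsumE.
have [f1 f2 _] := hf; have [c Ec] := vdet_eq0P v0 vu0.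
have c0 : c != 0.
  by apply: contraNneq u0 => c0; rewrite Ec c0; apply/eqP; congr (_, _); rewrite mul0r.
have [x vx _] := sum_vdet f v0.
have -> : corr f v u = \sum_(g : M | mdet g == 1) f (mact g v) * f (mact g v).
  by apply: eq_bigr => g _; rewrite Ec mact_scale f2.
have vx0 : vdet v x != 0 by rewrite vx oner_neq0.
rewrite (reindex_sl2 (fun a b => f a * f a) vx0) vx.
rewrite -(pair_big_dep xpredT (fun a b => vdet a b == 1) (fun a b => f a * f a)) /=.
have -> : - ip f f + true%:R * ((#|F|%:R + 1) * ip f f) = #|F|%:R * ip f f by rewrite mul1r; ring.
rewrite mulr_sumr; apply: eq_bigr => w _.
have [->|w0] := eqVneq w 0; first by rewrite f1 mul0r mulr0 big1.
have [y _ ->] := sum_vdet (fun=> f w * f w) w0.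
by rewrite sumr_const mulr_natl.
Qed.

(** The constant is the order q(q^2-1) of SL_2 over the dimension q of the representation. Expanding
    the square leaves the sum of h(v) h(u) [corr f v u]; the constant part of [corrE] disappears
    because h has mean zero, and the proportional pairs give (q+1)(q-1) by [sum_line]. *)
Lemma schur f h : hom0 f -> hom0 h ->
  \sum_(g : M | mdet g == 1) ip (pull g f) h ^+ 2 = (#|F| ^ 2 - 1)%:R * (ip f f * ip h h).
Proof.
move=> hf hh; have [h1 h2 h3] := hh.
have -> : \sum_(g : M | mdet g == 1) ip (pull g f) h ^+ 2 =
          \sum_v \sum_u h v * h u * corr f v u.
  transitivity (\sum_(g : M | mdet g == 1) \sum_v \sum_u h v * h u * (f (mact g v) * f (mact g u))).
    apply: eq_bigr => g _; rewrite expr2 /ip mulr_suml; apply: eq_bigr => v _.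
    rewrite mulr_sumr; apply: eq_bigr => u _; rewrite !ffunE /=; ring.
  rewrite exchange_big /=; apply: eq_bigr => v _; rewrite exchange_big /=.
  by apply: eq_bigr => u _; rewrite mulr_sumr.
transitivity (\sum_v \sum_u (h v * h u * - ip f f +
    (if vdet v u == 0 then h u else 0) * (h v * ((#|F|%:R + 1) * ip f f)))).
  apply: eq_bigr => v _; apply: eq_bigr => u _.
  have [->|v0] := eqVneq v 0; first by rewrite h1 !mul0r mulr0 addr0.
  have [->|u0] := eqVneq u 0; first by rewrite h1 !mulr0 !mul0r if_same mul0r addr0.
  by rewrite corrE //; case: ifP => _ /=; ring.
transitivity (\sum_v h v * ((#|F|%:R + 1) * ip f f) * ((#|F|.-1)%:R * h v)).
  apply: eq_bigr => v _; rewrite big_split /= -!mulr_suml -mulr_sumr h3 mulr0 mul0r add0r.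
  rewrite -big_mkcond /= mulrC.
  have [->|v0] := eqVneq v 0; first by rewrite h1 !mul0r.
  by rewrite sum_line.
have -> : (#|F| ^ 2 - 1)%:R = (#|F|%:R + 1) * (#|F|.-1)%:R :> R.
  rewrite -[in LHS](prednK (ltnW (card_gt1 F))) -[X in X%:R + 1](prednK (ltnW (card_gt1 F))).
  move: (#|F|.-1) => k; rewrite -natr1 (_ : (k.+1 ^ 2 - 1 = (k.+2) * k)%N); last by rewrite -mulnn; lia.
  by rewrite natrM -!natr1.
move: (ip f f) => I; rewrite /ip !mulr_sumr; apply: eq_bigr => v _; move: (h v : R) => x; ring.
Qed.

Definition mcollisions (W : seq M) := (\sum_(w <- W) count_mem w W)%N.

(** Write h as the sum over g of a(g) [pull g f], with a(g) the multiplicity of g in [W].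
    Cauchy-Schwarz over the group and [schur] bound [ip h h] squared by the sum of the a(g)^2 times
    (q^2-1) [ip f f] times [ip h h], and one factor [ip h h] cancels. *)
Lemma nm_sum_pull (W : seq M) f : hom0 f -> (forall w, w \in W -> mdet w = 1) ->
  nm (\sum_(w <- W) pull w f) ^+ 2 <= (mcollisions W * #|F| ^ 2)%:R * ip f f.
Proof.
move=> hf W1; set h := \sum_(w <- W) _.
have hh : hom0 h by apply: hom0_sum => w /W1 w1; apply: hom0_pull; rewrite // w1 oner_neq0.
pose a (g : M) : R := (count_mem g W)%:R.
have sumW (phi : M -> R) : \sum_(w <- W) phi w = \sum_(g | mdet g == 1) a g * phi g.
  rewrite -(big_undup_iterop_count (GRing.add : Monoid.com_law 0) W xpredT phi) /=.
  rewrite (big_uniq _ (undup_uniq W)) /= big_mkcond [RHS]big_mkcond /=; apply: eq_bigr => g _.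
  rewrite mem_undup /a; case: ifP => gW; first by rewrite W1 // eqxx Monoid.iteropE iter_addr_0 mulr_natl.
  have -> : count_mem g W = 0%N by apply/count_memPn; rewrite gW.
  by rewrite mul0r if_same.
have E : ip h h = \sum_(g | mdet g == 1) a g * ip (pull g f) h.
  by rewrite -(sumW (fun g => ip (pull g f) h)) -ip_suml.
have Ea : \sum_(g | mdet g == 1) a g ^+ 2 = (mcollisions W)%:R.
  by rewrite /mcollisions natr_sum (sumW a); apply: eq_bigr => g _; rewrite expr2.
have CS : ip h h ^+ 2 <= (\sum_(g | mdet g == 1) a g ^+ 2) *
    \sum_(g : M | mdet g == 1) ip (pull g f) h ^+ 2.
  pose A : {ffun M -> R^o} := [ffun g => if mdet g == 1 then a g else 0].
  pose B : {ffun M -> R^o} := [ffun g => if mdet g == 1 then ip (pull g f) h else 0].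
  have eAB : ip A B = \sum_(g | mdet g == 1) a g * ip (pull g f) h.
    by rewrite [RHS]big_mkcond; apply: eq_bigr => g _; rewrite !ffunE; case: ifP; rewrite ?mul0r.
  have eA : ip A A = \sum_(g | mdet g == 1) a g ^+ 2.
    by rewrite [RHS]big_mkcond; apply: eq_bigr => g _; rewrite !ffunE; case: ifP; rewrite ?mul0r.
  have eB : ip B B = \sum_(g : M | mdet g == 1) ip (pull g f) h ^+ 2.
    by rewrite [RHS]big_mkcond; apply: eq_bigr => g _; rewrite !ffunE; case: ifP; rewrite ?mul0r.
  by rewrite E -eAB -eA -eB cauchy_schwarz.
rewrite sqr_nm; have [h0|h0] := eqVneq h 0.
  rewrite h0 [ip 0 0](_ : _ = 0) ?mulr_ge0 ?ip_ge0 ?ler0n //.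
  by apply/eqP; rewrite ip_eq0.
have hpos : 0 < ip h h by rewrite lt0r ip_eq0 h0 ip_ge0.
rewrite -(ler_pM2r hpos) -expr2; apply: le_trans CS _.
rewrite Ea schur // natrM -!mulrA ler_wpM2l ?ler0n // ler_wpM2r ?mulr_ge0 ?ip_ge0 //.
by rewrite ler_nat leq_subr.
Qed.
End Schur.

(** * Two projections *)

Section TwoProjections.
Variables (F : finFieldType) (R : realType).
Notation V := (F * F)%type.
Notation M := (F * F * F * F)%type.
Notation fn := {ffun V -> R^o}.
Implicit Types f g h : fn.

Definition mU : M := (1, 1, 0, 1).
Definition mL : M := (1, 0, 1, 1).
Definition mS : M := (0, -1, 1, 0).
Definition mR : M := (0, 1, -1, -1).
Definition mR2 : M := (-1, -1, 1, 0).

Lemma mU_neq0 : mdet mU != 0. Proof. by rewrite /mdet /= mulr1 mulr0 subr0 oner_neq0. Qed.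
Lemma mL_neq0 : mdet mL != 0. Proof. by rewrite /mdet /= mulr1 mul0r subr0 oner_neq0. Qed.
Lemma mS_neq0 : mdet mS != 0. Proof. by rewrite /mdet /= mulr1 mul0r sub0r opprK oner_neq0. Qed.
Lemma mR_neq0 : mdet mR != 0. Proof. by rewrite /mdet /= mul0r mul1r sub0r opprK oner_neq0. Qed.
Lemma mR2_neq0 : mdet mR2 != 0. Proof. by rewrite /mdet /= mulr0 mulr1 sub0r opprK oner_neq0. Qed.

Definition opQ f := pull mU f + pull mL f.

Lemma opQD f g : opQ (f + g) = opQ f + opQ g.
Proof. by rewrite /opQ !pullD addrACA. Qed.
Lemma opQZ a f : opQ (a *: f) = a *: opQ f.
Proof. by rewrite /opQ !pullZ scalerDr. Qed.
Lemma nm_opQ f : nm (opQ f) <= 2 * nm f.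
Proof. by apply: le_trans (nmD _ _) _; rewrite !nm_pull ?mU_neq0 ?mL_neq0 // mulr2n mulrDl mul1r. Qed.

Let S f := pull mS f.
(** [E] is the orthogonal projection onto the functions invariant under [mR], which has order 3. *)
Let E f := 3^-1 *: (f + pull mR f + pull mR2 f).

Lemma pullSS f : hom0 f -> pull mS (pull mS f) = f.
Proof.
move=> hf; rewrite pullM -[RHS](@pull_scalar _ _ (-1)) ?oppr_eq0 ?oner_eq0 //.
by congr pull; rewrite /mmul /=; congr (_, _, _, _); ring.
Qed.

Lemma opQ_SR f : hom0 f -> opQ f = pull mR (pull mS f) + pull mR2 (pull mS f).
Proof.
move=> hf; rewrite /opQ; congr (_ + _); rewrite pullM.
  by congr pull; rewrite /mmul /=; congr (_, _, _, _); ring.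
have -> : mmul mS mR2 = mmul (-1, 0, 0, -1) mL.
  by rewrite /mmul /=; congr (_, _, _, _); ring.
by rewrite -pullM pull_scalar // oppr_eq0 oner_neq0.
Qed.

Lemma pullR2 f : pull mR (pull mR f) = pull mR2 f.
Proof. by rewrite pullM; congr pull; rewrite /mmul /=; congr (_, _, _, _); ring. Qed.

Lemma pullR3 f : pull mR (pull mR2 f) = f.
Proof.
by rewrite pullM; apply/ffunP => -[x y]; rewrite ffunE; congr (f (_, _)); rewrite /=; ring.
Qed.

Let pullRE f : pull mR (E f) = E f.
Proof.
by rewrite /E pullZ !pullD pullR2 pullR3 addrC addrA.
Qed.

Let ipEl f g : pull mR g = g -> ip (E f) g = ip f g.
Proof.
move=> gR; have gR2 : pull mR2 g = g by rewrite -pullR2 !gR.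
have h1 : ip (pull mR f) g = ip f g by rewrite -{1}gR ip_pull ?mR_neq0.
have h2 : ip (pull mR2 f) g = ip f g by rewrite -{1}gR2 ip_pull ?mR2_neq0.
by rewrite /E ipZl !ipDl h1 h2; move: (ip f g) => x; field.
Qed.

Let ipS f g : hom0 f -> ip (S f) g = ip f (S g).
Proof. by move=> hf; rewrite -(ip_pull _ _ mS_neq0) pullSS. Qed.

Let ipS_le f : ip (S f) f <= ip f f.
Proof. by apply: le_trans (ip_le_nm _ _) _; rewrite nm_pull ?mS_neq0 // -expr2 sqr_nm. Qed.

Let ipS_ge f : - ip (S f) f <= ip f f.
Proof.
by rewrite -ipNl; apply: le_trans (ip_le_nm _ _) _; rewrite nmN nm_pull ?mS_neq0 // -expr2 sqr_nm.
Qed.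

Let hom0E f : hom0 f -> hom0 (E f).
Proof.
move=> hf; apply: hom0Z; apply: hom0D; last by apply: hom0_pull; rewrite ?mR2_neq0.
by apply: hom0D => //; apply: hom0_pull; rewrite ?mR_neq0.
Qed.

Let opQ_inv f : hom0 f -> pull mR f = f -> opQ f = 3 *: E (S f) - S f.
Proof.
move=> hf fR; rewrite opQ_SR // /E scalerA mulfV ?scale1r; last by rewrite pnatr_eq0.
by rewrite -(addrA (S f)) [RHS]addrAC subrr add0r.
Qed.

Let opQ_S f : hom0 f -> pull mR f = f -> opQ (S f) = 2 *: f.
Proof.
move=> hf fR; rewrite opQ_SR; last by apply: hom0_pull; rewrite ?mS_neq0.
by rewrite pullSS // -pullR2 !fR scaler_nat mulr2n.
Qed.

(** An approximate eigenvector stays one under iteration, as Q has norm at most 2. The constant must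
    not depend on u and g: the precision of the approximation is chosen after it. *)
Let iter_opQ_approx (rho : R) m : exists2 C, 0 <= C & forall u g,
  opQ u = rho *: u - 3 *: g -> nm (iter m opQ u - rho ^+ m *: u) <= C * nm g.
Proof.
elim: m => [|m [C C0 IHm]].
  by exists 0 => // u g _; rewrite /= expr0 scale1r subrr nm0 mul0r.
exists (2 * C + `|rho ^+ m| * 3); first by rewrite addr_ge0 ?mulr_ge0.
move=> u g Qu; have le1 := IHm u g Qu.
have -> : iter m.+1 opQ u - rho ^+ m.+1 *: u =
    opQ (iter m opQ u - rho ^+ m *: u) - (rho ^+ m * 3) *: g.
  rewrite iterS; set d := _ - rho ^+ m *: u.
  rewrite (_ : iter m opQ u = d + rho ^+ m *: u); last by rewrite subrK.
  by rewrite opQD opQZ Qu scalerBr !scalerA -exprSr addrA addrAC addrK.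
apply: le_trans (nmB _ _) _; rewrite nmZ normrM (ger0_norm (x := 3)) // mulrDl lerD //.
by apply: le_trans (nm_opQ _) _; rewrite -mulrA ler_wpM2l.
Qed.

(* On an eigenvector f of E S with eigenvalue lam, the operator Q preserves the plane
   spanned by f and S f, where its characteristic polynomial is X^2 - 3 lam X + 2. The
   supremum lam need not be attained a priori, so approximate eigenvectors are used. *)
Lemma two_projections (m : nat) (delta rho0 : R) :
  3 / 2 <= rho0 -> delta < rho0 ^+ m ->
  (forall f, hom0 f -> nm (iter m opQ f) <= delta * nm f) ->
  forall f, hom0 f -> pull mR f = f -> ip (pull mS f) f <= (rho0 + 2 / rho0) / 3 * ip f f.
Proof.
move=> rho0_ge lt_delta Hm f1 hf1 f1R; set lam0 := (rho0 + _) / 3.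
have rho0_gt0 : 0 < rho0 by apply: lt_le_trans rho0_ge; rewrite divr_gt0.
rewrite leNgt; apply/negP => f1_gt.
have pos_of h : h != 0 -> 0 < ip h h by move=> h0; rewrite lt0r ip_eq0 h0 ip_ge0.
pose A : set R := [set x : R | exists h, [/\ hom0 h, pull mR h = h, h != 0 & x = ip (S h) h / ip h h]]%classic.
have f10 : f1 != 0.
  apply: contraTneq f1_gt => ->; rewrite -leNgt.
  by rewrite ip0l mulr0 -(ip0l (0 : fn)) ipS_le.
have A_f1 : A (ip (S f1) f1 / ip f1 f1) by exists f1.
have A_sup : has_sup A.
  split; first by exists (ip (S f1) f1 / ip f1 f1).
  by exists 1 => _ [h [_ _ h0 ->]]; rewrite ler_pdivrMr ?pos_of // mul1r.
pose lam := sup A.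
have lam_gt : lam0 < lam.
  apply: (@lt_le_trans _ _ (ip (S f1) f1 / ip f1 f1)); first by rewrite ltr_pdivlMr ?pos_of.
  exact: ub_le_sup A_sup.2 _ A_f1.
have lam_le1 : lam <= 1.
  apply: ge_sup A_sup.1 _ => _ [h [_ _ h0 ->]]; rewrite ler_pdivrMr ?pos_of // mul1r //.
have lamP h : hom0 h -> pull mR h = h -> ip (S h) h <= lam * ip h h.
  move=> hh hR; have [->|h0] := eqVneq h 0.
    by rewrite ip0l mulr0 -(ip0l (0 : fn)) ipS_le.
  by rewrite -ler_pdivrMr ?pos_of //; apply: ub_le_sup A_sup.2 _ _; exists h.
have lam0_ge : rho0 + 2 / rho0 = 3 * lam0 by rewrite /lam0; field; rewrite gt_eqF.
(* The larger root of X^2 - 3 lam X + 2. For [lam0] the larger root is [rho0], so lam > lam0 yields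
   rho >= rho0. *)
pose rho := (3 * lam + Num.sqrt (9 * lam ^+ 2 - 8)) / 2.
have h2rho : 2 / rho0 <= rho0.
  by rewrite ler_pdivrMr //; nra.
have disc_ge : (rho0 - 2 / rho0) ^+ 2 <= 9 * lam ^+ 2 - 8.
  have -> : (rho0 - 2 / rho0) ^+ 2 = (rho0 + 2 / rho0) ^+ 2 - 8 by field; rewrite gt_eqF.
  rewrite lam0_ge; have : 0 < lam0 by rewrite divr_gt0 // addr_gt0 // divr_gt0.
  nra.
have rhoE : rho ^+ 2 = 3 * lam * rho - 2.
  have := sqr_sqrtr (le_trans (sqr_ge0 _) disc_ge); rewrite /rho.
  move: (Num.sqrt _) => s Es; rewrite (_ : ((3 * lam + s) / 2) ^+ 2 = (9 * lam ^+ 2 + 6 * lam * s + s ^+ 2) / 4); last by field.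
  by rewrite Es; field.
have rho_ge : rho0 <= rho.
  have : rho0 - 2 / rho0 <= Num.sqrt (9 * lam ^+ 2 - 8).
    rewrite -[leLHS]ger0_norm ?subr_ge0 // -sqrtr_sqr; exact: ler_wsqrtr.
  by rewrite /rho; lra.
have rho_gt0 : 0 < rho by apply: lt_le_trans rho_ge.
clearbody rho.
have [C C0 HC] := iter_opQ_approx rho m.
(* With u as below, growth by rho^m against the assumed bound delta will give (rho^m - delta) |u| <=
   C |g|, while |u| >= |f|/3. The precision [th] is such that |g|^2 <= 2 th |f|^2 contradicts
   this. *)
pose tau := (rho ^+ m - delta) / 3.
have tau_gt0 : 0 < tau.
  rewrite divr_gt0 // subr_gt0 (lt_le_trans lt_delta) //.
  by apply: lerXn2r; rewrite ?nnegrE ?(ltW rho0_gt0) ?(ltW rho_gt0).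
pose th := tau ^+ 2 / (4 * (C ^+ 2 + 1)).
have C2 : 0 < C ^+ 2 + 1 by rewrite ltr_wpDl ?sqr_ge0.
have th_gt0 : 0 < th by rewrite divr_gt0 ?exprn_gt0 // mulr_gt0.
have [_ [f [hf fR f0 ->]] f_gt] := sup_adherent th_gt0 A_sup.
rewrite -/lam ltr_pdivlMr ?pos_of // in f_gt.
have hS := hom0_pull mS_neq0 hf.
have [g gE] : exists g, g = lam *: f - E (S f) by exists (lam *: f - E (S f)).
have hg : hom0 g by rewrite gE; apply: hom0D; [apply: hom0Z|apply/hom0N/hom0E].
have gR : pull mR g = g by rewrite gE pullD pullZ pullN fR pullRE.
(* By the choice of [lam], this form is nonnegative on invariant functions. As B(f, g) = |g|^2,
   Cauchy-Schwarz gives |g|^4 <= B(f, f) B(g, g) <= th |f|^2 * 2 |g|^2, so the residual g is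
   small. *)
pose B x y := lam * ip x y - ip (S x) y.
have CS : B f g ^+ 2 <= B f f * B g g.
  apply: (@cauchy_schwarz_form _ _ B) => a.
  have hh : hom0 (f + a *: g) by apply: hom0D => //; apply: hom0Z.
  have := lamP _ hh; rewrite pullD pullZ fR gR => /(_ erefl).
  have e1 : ip (pull mS g) f = ip (pull mS f) g by rewrite (ipS _ hg) ipC.
  rewrite /S !pullE -subr_ge0 !ipE e1 (ipC g f) /B /S.
  by congr (_ <= _); ring.
have BfgE : B f g = ip g g.
  by rewrite /B -(ipEl (S f) gR) -ipZl -ipNl -ipDl -gE.
have Bgg : B g g <= 2 * ip g g.
  have := ipS_ge g; have := ip_ge0 g; rewrite /B; nra.
have Bff : B f f <= th * ip f f by rewrite /B; move: f_gt; lra.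
have gg_le : ip g g <= 2 * th * ip f f.
  have [->|g0] := eqVneq g 0.
    by rewrite ip0l mulr_ge0 ?ip_ge0 // mulr_ge0 // ltW.
  rewrite -(ler_pM2r (pos_of _ g0)) -expr2 -BfgE; apply: le_trans CS _; rewrite BfgE.
  apply: (@le_trans _ _ (th * ip f f * B g g)).
    by rewrite ler_wpM2r // /B subr_ge0 lamP.
  rewrite (_ : 2 * th * _ * _ = th * ip f f * (2 * ip g g)); last by ring.
  by rewrite ler_wpM2l // mulr_ge0 ?ip_ge0 // ltW.
(* If g were 0, then Q u = (3 lam - 2/rho) f - S f = rho u. *)
pose u := f - rho^-1 *: S f.
have Qu : opQ u = rho *: u - 3 *: g.
  rewrite /u -scaleN1r scalerA opQD opQZ opQ_inv // opQ_S // gE.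
  apply/ffunP => v; rewrite !ffunE /= /GRing.scale /=; move: (f v) => x.
  have E1 : 3 * lam = rho + 2 / rho.
    by apply: (mulIf (lt0r_neq0 rho_gt0)); rewrite [RHS]mulrDl divfK ?gt_eqF // -expr2 rhoE subrK.
  have E2 : lam = (rho + 2 / rho) / 3 by rewrite -E1; field.
  by rewrite E2; field; rewrite gt_eqF.
have nu_ge : nm f / 3 <= nm u.
  have : nm f <= nm u + rho^-1 * nm f.
    have le_u := nmD u (rho^-1 *: S f).
    rewrite subrK in le_u; apply: le_trans le_u _.
    by rewrite nmZ nm_pull ?mS_neq0 // ger0_norm // invr_ge0 ltW.
  have : rho^-1 <= 2 / 3 by rewrite -[2 / 3]invf_div lef_pV2 ?posrE ?divr_gt0 //; apply: le_trans rho_ge.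
  have := nm_ge0 f; nra.
have hu : hom0 u by apply: hom0D => //; apply/hom0N/hom0Z.
have nf_gt0 : 0 < nm f by rewrite nm_gt0.
have main : tau * nm f <= C * nm g.
  apply: (@le_trans _ _ ((rho ^+ m - delta) * nm u)).
    have d0 : 0 <= rho ^+ m - delta.
      by have : 0 < (rho ^+ m - delta) / 3 := tau_gt0; move: (_ - delta) => d; lra.
    by rewrite /tau -mulrA (mulrC 3^-1) ler_wpM2l.
  rewrite mulrBl lerBlDr addrC.
  have -> : rho ^+ m * nm u = nm (rho ^+ m *: u).
    by rewrite nmZ ger0_norm // exprn_ge0 // ltW.
  apply: le_trans (_ : nm (iter m opQ u) + nm (iter m opQ u - rho ^+ m *: u) <= _).
    by rewrite nm_distC addrC; apply: le_trans (nmD _ _); rewrite subrK.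
  by rewrite lerD // ?Hm // HC.
clearbody tau.
have : (tau * nm f) ^+ 2 <= (C * nm g) ^+ 2.
  by apply: lerXn2r; rewrite ?nnegrE ?mulr_ge0 ?nm_ge0 ?(ltW tau_gt0).
rewrite !exprMn !sqr_nm; apply/negP; rewrite -ltNge.
apply: (@le_lt_trans _ _ (C ^+ 2 * (2 * th * ip f f))); first by rewrite ler_wpM2l ?sqr_ge0.
rewrite !mulrA ltr_pM2r ?pos_of // /th.
rewrite (_ : _ / _ = tau ^+ 2 * (C ^+ 2 / (2 * (C ^+ 2 + 1)))); last by field; rewrite gt_eqF.
rewrite gtr_pMr ?exprn_gt0 // ltr_pdivrMr ?mulr_gt0 // mul1r.
by have := sqr_ge0 C; lra.
Qed.
End TwoProjections.

(** * The averaging operator of the digits 1 and 2 *)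

Section Gap.
Variables (F : finFieldType) (R : realType).
Notation V := (F * F)%type.
Notation M := (F * F * F * F)%type.
Notation fn := {ffun V -> R^o}.
Implicit Types f g h : fn.

Definition mA (b : nat) : M := (b%:R, 1, 1, 0).

Lemma mA_neq0 b : mdet (mA b) != 0.
Proof. by rewrite /mdet /= mulr0 mulr1 sub0r oppr_eq0 oner_neq0. Qed.

Definition opP f := 2^-1 *: (pull (mA 1) f + pull (mA 2) f).

Lemma hom0_opP f : hom0 f -> hom0 (opP f).
Proof. by move=> hf; apply: hom0Z; apply: hom0D; apply: hom0_pull; rewrite ?mA_neq0. Qed.

Lemma pull_mA2 f : pull (mA 2) f = pull (mA 1) (pull (mU F) f).
Proof. by rewrite pullM; congr pull; rewrite /mmul /=; congr (_, _, _, _); ring. Qed.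

(** The parallelogram identity for f and its image under U: what one averaging loses is measured by
    how far f is from being U-invariant. *)
Lemma ip_opP f : ip (opP f) (opP f) = ip f f - 4^-1 * nm (pull (mU F) f - f) ^+ 2.
Proof.
rewrite /opP pull_mA2 -pullD !ipE ip_pull ?mA_neq0 // sqr_nm !ipE ip_pull ?mU_neq0 //.
by rewrite (ipC f); field.
Qed.

Definition mJ : M := (0, 1, 1, 0).
Lemma mJ_neq0 : mdet mJ != 0.
Proof. by rewrite /mdet /= mulr0 mulr1 sub0r oppr_eq0 oner_neq0. Qed.

Let nmp (g : M) f h : mdet g != 0 -> nm (pull g f - pull g h) = nm (f - h).
Proof. by move=> g0; rewrite -pullN -pullD nm_pull. Qed.

(** Let a and b measure the failure of U-invariance of f and of P f. If both are small, P f is close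
    to J f, and U J-conjugates to L, so f is almost invariant under U and L, hence under S and the
    rotation of order 3. Projecting f to the invariants of the latter contradicts the gap for S.
    Thus a + b >= (eta/40) |f|, and the total loss (a^2 + b^2)/4 is at least (a + b)^2/8, where 8 *
    40^2 = 12800. *)
Lemma opP_gap (eta : R) : 0 < eta <= 1 ->
  (forall f, hom0 f -> pull (mR F) f = f -> ip (pull (mS F) f) f <= (1 - eta) * ip f f) ->
  forall f, hom0 f -> ip (opP (opP f)) (opP (opP f)) <= (1 - eta ^+ 2 / 12800) * ip f f.
Proof.
move=> /andP[eta0 eta1] Hgap f hf.
set U := @pull F R (mU F); set L := @pull F R (mL F).
set S := @pull F R (mS F); set Rr := @pull F R (mR F).
set J := @pull F R mJ; set P := opP.
have U0 := mU_neq0 F; have L0 := mL_neq0 F; have S0 := mS_neq0 F; have R0 := mR_neq0 F.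
have J0 := mJ_neq0.
set a := nm (U f - f); set b := nm (U (P f) - P f).
have a0 : 0 <= a by apply: nm_ge0. have b0 : 0 <= b by apply: nm_ge0.
have PJ : nm (P f - J f) <= 2 * a.
  have e1 : pull (mA 1) f = J (U f).
    by rewrite /J /U pullM; congr pull; rewrite /mmul /=; congr (_, _, _, _); ring.
  have n1 : nm (pull (mA 1) f - J f) = a by rewrite e1 /J nmp.
  have n2 : nm (pull (mA 2) f - J f) <= 2 * a.
    apply: le_trans (nm_dist _ (pull (mA 1) f) _) _.
    by rewrite n1 pull_mA2 nmp ?mA_neq0 // -/a mulr2n mulrDl mul1r.
  have -> : P f - J f = 2^-1 *: ((pull (mA 1) f - J f) + (pull (mA 2) f - J f)).
    by apply/ffunP => v; rewrite !ffunE /= /GRing.scale /=; field.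
  rewrite nmZ ger0_norm ?invr_ge0 //; have := nmD (pull (mA 1) f - J f) (pull (mA 2) f - J f).
  by rewrite n1; lra.
have Lf : nm (L f - f) <= 4 * a + b.
  rewrite -(nmp _ _ J0) -/J.
  have -> : J (L f) = U (J f).
    by rewrite /J /L /U !pullM; congr pull; rewrite /mmul /=; congr (_, _, _, _); ring.
  apply: le_trans (nm_dist _ (U (P f)) _) _; rewrite nmp // nm_distC.
  have := nm_dist (U (P f)) (P f) (J f); rewrite -/b; lra.
have Sf : nm (S f - f) <= 6 * a + b.
  rewrite -(nmp _ _ U0) -/U.
  have e1 : U (S (U f)) = L f.
    by rewrite /L /S /U !pullM; congr pull; rewrite /mmul /=; congr (_, _, _, _); ring.
  have := nm_dist (U (S f)) (L f) (U f); have := nm_dist (L f) f (U f).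
  have := nmp f (U f) S0; rewrite -/S -(nmp _ _ U0) -/U e1 (nm_distC f) -/a; lra.
have Rf : nm (Rr f - f) <= 7 * a + b.
  have e1 : U f = Rr (S f).
    by rewrite /Rr /S /U !pullM; congr pull; rewrite /mmul /=; congr (_, _, _, _); ring.
  have := nm_dist (Rr f) (Rr (S f)) f; rewrite nmp // (nm_distC f) -e1 -/a; lra.
have R2f : nm (pull (mR2 F) f - f) <= 2 * (7 * a + b).
  have := nm_dist (Rr (Rr f)) (Rr f) f; rewrite nmp // /Rr pullR2 -/Rr; lra.
pose e := 3^-1 *: (f + Rr f + pull (mR2 F) f).
have ef : nm (e - f) <= 7 * a + b.
  have -> : e - f = 3^-1 *: ((Rr f - f) + (pull (mR2 F) f - f)).
    by apply/ffunP => v; rewrite !ffunE /= /GRing.scale /=; field.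
  rewrite nmZ ger0_norm ?invr_ge0 //; have := nmD (Rr f - f) (pull (mR2 F) f - f); lra.
have he : hom0 e.
  apply: hom0Z; apply: hom0D; first by apply: hom0D => //; apply: hom0_pull.
  by apply: hom0_pull; rewrite ?mR2_neq0.
have eR : Rr e = e by rewrite /e /Rr pullZ !pullD pullR2 pullR3 addrC addrA.
clearbody e.
have Se : nm (S e - e) <= 20 * a + 3 * b.
  have := nm_dist (S e) (S f) e; have := nm_dist (S f) f e.
  by rewrite (nm_distC f) nmp //; lra.
have Se2 : 2 * eta * ip e e <= nm (S e - e) ^+ 2.
  have := Hgap e he eR; rewrite sqr_nm !ipE ip_pull // (ipC e) -/S; lra.
have ne : nm f <= nm e + (7 * a + b).
  by have := nmD e (f - e); rewrite addrC subrK (nm_distC f); lra.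
rewrite -sqr_nm in Se2.
rewrite ip_opP -/P ip_opP -/U -/a -/b -(sqr_nm f).
have ab : eta / 40 * nm f <= a + b.
  (* Otherwise |e| >= |f|/2 and |S e - e| <= 20(a + b) <= (eta/2) |f|, so that [Se2] would give
     eta/2 <= eta^2/4, against eta <= 1. *)
  rewrite leNgt; apply/negP => lt_ab.
  have nf0 := nm_ge0 f; have ne0 := nm_ge0 e.
  have ne2 : nm f / 2 <= nm e by nra.
  have d1 : nm (S e - e) ^+ 2 <= (eta / 2 * nm f) ^+ 2.
    apply: lerXn2r; rewrite ?nnegrE ?nm_ge0 ?mulr_ge0 ?divr_ge0 ?(ltW eta0) //; nra.
  have d2 : (nm f / 2) ^+ 2 <= nm e ^+ 2.
    by apply: lerXn2r; rewrite ?nnegrE ?nm_ge0 ?divr_ge0.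
  have nfp : 0 < nm f.
    rewrite lt0r nf0 andbT; apply: contraTneq lt_ab => ->.
    by rewrite mulr0 -leNgt addr_ge0.
  have : 0 < eta * nm f ^+ 2 by rewrite mulr_gt0 // exprn_gt0.
  nra.
have ab2 : (eta / 40 * nm f) ^+ 2 <= (a + b) ^+ 2.
  apply: lerXn2r; rewrite ?nnegrE ?(addr_ge0 a0 b0) //.
  by rewrite mulr_ge0 ?nm_ge0 // divr_ge0 // ltW.
have : 0 <= (a - b) ^+ 2 by apply: sqr_ge0.
rewrite mulrBl mul1r; move: ab2; rewrite !exprMn sqrrD sqrrB exprVn.
rewrite (_ : 40 ^+ 2 = 1600 :> R); last by ring.
move: (a ^+ 2) (b ^+ 2) (a * b) (nm f ^+ 2) (eta ^+ 2) => x y z t u; lra.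
Qed.

End Gap.

(** * From the contraction to a path reaching the line {x = 0} *)

Section Path.
Variables (F : finFieldType) (R : realType).
Notation V := (F * F)%type.
Notation fn := {ffun V -> R^o}.
Implicit Types f g h : fn.

Definition cfact (b : nat) (v : V) := mact (mA F b) v.

Definition letters12 (w : seq nat) := all (fun b => (0 < b <= 2)%N) w.

(** The value of P^n f at v is the average of f over the images of v under all words of length n.
    With [foldr] the last letter acts first, whence the extension of words by [rcons]. *)
Lemma iter_opP_const f (c : R) n (v : V) :
  (forall w, size w = n -> letters12 w -> f (foldr cfact v w) = c) ->
  iter n (@opP F R) f v = c.
Proof.
elim: n v => [|n IHn] v H; first by rewrite -[RHS](H [::]).
have step b : (0 < b <= 2)%N -> iter n (@opP F R) f (cfact b v) = c.
  move=> hb; apply: IHn => w sw lw; rewrite -[RHS](H (rcons w b)).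
  - by rewrite foldr_rcons.
  - by rewrite size_rcons sw.
  - by rewrite /letters12 all_rcons hb.
rewrite iterS /opP !ffunE /= -!/(cfact _ v) !step //.
by rewrite /GRing.scale /=; field.
Qed.

(** If no word reaches {x = 0}, the iterate of the centred indicator f of this line has the value
    -1/(q+1) at v, which is too large for the decay of its norm from at most q. *)
Lemma path_to_zero (kappa : R) n (v : V) :
  (forall f, hom0 f -> ip (opP (opP f)) (opP (opP f)) <= (1 - kappa) * ip f f) ->
  (1 - kappa) ^+ n * (#|F|%:R * (#|F|%:R + 1)) ^+ 2 < 1 -> kappa <= 1 -> v != 0 ->
  exists w, [/\ size w = (2 * n)%N, letters12 w & (foldr cfact v w).1 = 0].
Proof.
move=> Hgap Hn k1 v0; set q : R := #|F|%:R in Hn *.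
have q0 : 0 < q by rewrite ltr0n (ltn_trans _ (card_gt1 F)).
(* The line {x = 0} is one of q+1 lines through the origin; subtracting its density 1/(q+1) makes
   the mean zero. *)
pose f : fn := [ffun u : V => if u == 0 then 0 else (u.1 == 0)%:R - (q + 1)^-1].
have f_ne (u : V) : u != 0 -> f u = (u.1 == 0)%:R - (q + 1)^-1 by move=> u0; rewrite ffunE (negbTE u0).
have hf : hom0 f.
  split; first by rewrite ffunE eqxx.
    move=> c u c0; rewrite !ffunE /vscale /= mulf_eq0 (negbTE c0) /=.
    by congr (if _ then _ else _); rewrite !xpair_eqE !mulf_eq0 !(negbTE c0).
  pose G (u : V) : R := (u.1 == 0)%:R - (q + 1)^-1.
  have sumG : \sum_u G u = q - q ^+ 2 * (q + 1)^-1.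
    rewrite big_split /= sumr_const card_prod mulNrn -[X in _ - X]mulr_natl natrM -expr2 -/q.
    congr (_ - _); rewrite -(pair_bigA _ (fun x _ : F => (x == 0)%:R)) /= (bigD1 0) //=.
    rewrite [X in _ + X]big1 ?addr0; first by rewrite eqxx sumr_const.
    by move=> x /negbTE ->; rewrite sumr_const mul0rn.
  have -> : \sum_u f u = \sum_u G u - G 0.
    rewrite (bigD1 (0 : V)) //= ffunE eqxx add0r [in RHS](bigD1 (0 : V)) //= [RHS]addrC addKr.
    by apply: eq_bigr => u /f_ne.
  by rewrite sumG /G eqxx mulr1n; field; rewrite gt_eqF // addr_gt0.
have it_hom k : hom0 (iter k (@opP F R) f) by elim: k => // k; apply: hom0_opP.
pose N k := ip (iter (2 * k) (@opP F R) f) (iter (2 * k) (@opP F R) f).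
have N_le k : N k <= (1 - kappa) ^+ k * N 0%N.
  elim: k => [|k IHk]; first by rewrite expr0 mul1r.
  rewrite /N mulnS exprS -mulrA; apply: le_trans (Hgap _ (it_hom _)) _.
  by rewrite ler_wpM2l // subr_ge0.
have N0_le : N 0%N <= q ^+ 2.
  have -> : q ^+ 2 = \sum_(u : V) 1 by rewrite sumr_const card_prod natrM -expr2.
  apply: ler_sum => u _; rewrite ffunE; case: ifP => _; first by rewrite mul0r.
  have c0 : 0 <= (q + 1)^-1 by rewrite invr_ge0 addr_ge0 // ltW.
  have c1 : (q + 1)^-1 <= 1 by rewrite invf_le1 ?lerDr ?addr_gt0 // ltW.
  case: (u.1 == 0); rewrite /=; nra.
(* Tuples over ['I_3] form a finite type, so the existence of a word is decidable. *)
have [/existsP[w /andP[lw /eqP w0]]|none] :=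
    boolP [exists w : (2 * n).-tuple 'I_3, letters12 (map val w) && ((foldr cfact v (map val w)).1 == 0)].
  by exists (map val w); rewrite size_map size_tuple.
exfalso; have val_const : iter (2 * n) (@opP F R) f v = - (q + 1)^-1.
  apply: iter_opP_const => w sw lw.
  have w_ne : foldr cfact v w != 0.
    elim: w {sw lw} => //= b w; apply: contraNneq => E.
    have /(bij_inj) inj := mact_bij (mA_neq0 F b).
    by apply/eqP/inj; rewrite mact0.
  rewrite f_ne // (_ : (_ == 0) = false) ?sub0r //; apply: contraNF none => w0.
  have w3 : all (fun b => b < 3)%N w by apply: sub_all lw => b /andP[].
  have wE : [seq val (inord b : 'I_3) | b <- w] = w.
    by rewrite -[RHS]map_id; apply/eq_in_map => b /(allP w3) b3; rewrite /= inordK.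
  have sw' : size [seq (inord b : 'I_3) | b <- w] == (2 * n)%N by rewrite size_map sw.
  by apply/existsP; exists (Tuple sw'); rewrite /= -map_comp wE lw w0.
have : ((q + 1)^-1) ^+ 2 <= (1 - kappa) ^+ n * q ^+ 2.
  apply: (@le_trans _ _ (N n)).
    rewrite /N /ip (bigD1 v) //= val_const mulrNN -expr2 lerDl.
    by apply: sumr_ge0 => u _; rewrite -expr2 sqr_ge0.
  by apply: le_trans (N_le n) _; rewrite ler_wpM2l // exprn_ge0 // subr_ge0.
rewrite exprVn -(@ler_pM2r _ ((q + 1) ^+ 2)) ?exprn_gt0 ?addr_gt0 //.
rewrite mulVf ?expf_neq0 ?gt_eqF ?addr_gt0 // -mulrA -exprMn.
by rewrite leNgt Hn.
Qed.

End Path.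

(** * Spectral gap over F_p *)

Section Combine.
Variable R : realType.

Section Words.
Variable p : nat.
Hypothesis p_pr : prime p.
Notation F := 'F_p.
Notation V := (F * F)%type.
Notation M := (F * F * F * F)%type.
Notation fn := {ffun V -> R^o}.

Definition qred (w : quad) : M := (w.1.1.1%:~R, w.1.1.2%:~R, w.1.2%:~R, w.2%:~R).

Lemma iter_opQE m (f : fn) : iter m (@opQ F R) f = \sum_(w <- words m) pull (qred w) f.
Proof.
elim: m => [|m IHm].
  by rewrite big_seq1; apply/ffunP => -[x y]; rewrite ffunE /mact /= !mul1r !mul0r addr0 add0r.
rewrite iterS IHm [words _]/= big_cat !big_map /opQ.
have pull_sum (g : M) (G : quad -> fn) s : pull g (\sum_(w <- s) G w) = \sum_(w <- s) pull g (G w).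
  elim: s => [|w s IHs]; first by rewrite !big_nil; apply/ffunP => v; rewrite !ffunE.
  by rewrite !big_cons pullD IHs.
by rewrite !pull_sum; congr (_ + _); apply: eq_bigr => -[[[a b] c] d] _; rewrite pullM;
  congr pull; rewrite /mmul /qred /=; congr (_, _, _, _); rewrite ?intrD; ring.
Qed.

Lemma mdet_qred w : mdet (qred w) = (qdet w)%:~R.
Proof. by rewrite /mdet /qdet /= rmorphB !rmorphM. Qed.

Lemma qred_eq w w' : (qred w' == qred w) = qcong p w w'.
Proof.
have E (i j : int) : (i%:~R == j%:~R :> F) = (p %| i - j)%Z.
  by rewrite (dvdz_pcharf (pchar_Fp p_pr)) rmorphB subr_eq0.
by rewrite /qred !xpair_eqE !E /qcong -!andbA.
Qed.

Lemma mcollisions_qred W : mcollisions (map qred W) = collisions p W.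
Proof.
rewrite /mcollisions /collisions big_map; apply: eq_bigr => w _.
by rewrite count_map size_filter; apply: eq_count => w' /=; rewrite qred_eq.
Qed.

(** The Schur bound handles the short words, the triangle inequality the long ones. *)
Lemma nm_iter_opQ m Rad (f : fn) : hom0 f ->
  nm (iter m (@opQ F R) f) <=
  (Num.sqrt (collisions p (short_words m Rad) * p ^ 2)%:R + (size (long_words m Rad))%:R) * nm f.
Proof.
move=> hf; rewrite iter_opQE (bigID (fun w => qsum w <= Rad%:Z)) /= mulrDl.
have W1 w : w \in words m -> mdet (qred w) = 1 by move=> /words_det E; rewrite mdet_qred E.
apply: le_trans (nmD _ _) (lerD _ _).
  rewrite -big_filter -/(short_words m Rad) -(big_map qred xpredT (fun g => pull g f)).
  rewrite -ler_sqr ?nnegrE ?mulr_ge0 ?sqrtr_ge0 ?nm_ge0 // exprMn !sqr_nm sqr_sqrtr ?ler0n //.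
  have := @nm_sum_pull F R (map qred (short_words m Rad)) f hf.
  rewrite sqr_nm mcollisions_qred card_Fp //; apply => _ /mapP[w + ->].
  by rewrite mem_filter => /andP[_ /W1].
rewrite -big_filter -/(long_words m Rad); apply: le_trans (nm_sum _ _) _.
rewrite big_seq (eq_bigr (fun=> nm f)); last first.
  by move=> w; rewrite mem_filter => /andP[_ /W1 w1]; rewrite nm_pull // w1 oner_neq0.
by rewrite -big_seq big_const_seq count_predT iter_addr_0 mulr_natl.
Qed.
End Words.

Lemma nat_root k n : (0 < k)%N -> (0 < n)%N ->
  exists2 y, (0 < y)%N & (y ^ k <= n < y.+1 ^ k)%N.
Proof.
move=> k0 n0; have exy : exists y, (n < y.+1 ^ k)%N.
  by exists n; apply: leq_trans (ltnSn n) _; rewrite -[n.+1 in leqLHS]expn1 leq_pexp2l.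
case: (ex_minnP exy) => y ny y_min; case: y ny y_min => [|y] ny y_min.
  by rewrite exp1n ltnS leqNgt n0 in ny.
exists y.+1 => //; rewrite ny andbT leqNgt; apply/negP => /y_min; rewrite ltnn //.
Qed.

Lemma gap_Fp : exists p0, forall p, prime p -> (p0 <= p)%N ->
  forall f : {ffun 'F_p * 'F_p -> R^o}, hom0 f -> pull (mR _) f = f ->
  ip (pull (mS _) f) f <= (1 - 4000^-1) * ip f f.
Proof.
have [C HC] := word_statistics.
pose D := (C + 3)%N.
exists ((2 * D ^ 2).+1 ^ 100)%N => p p_pr p_ge f hf fR.
have [y y0 /andP[yp py]] := nat_root (isT : (0 < 100)%N) (prime_gt0 p_pr).
have y_big : (2 * D ^ 2 < y)%N.
  have : ((2 * D ^ 2).+1 ^ 100 < y.+1 ^ 100)%N by apply: leq_ltn_trans py.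
  by rewrite ltn_exp2r.
have [|m [Rad [h1 h2 h3]]] := HC y p y0.
  by rewrite yp (leq_trans (ltnW py)) // leq_exp2r // mul2n -addnn -addn1 leq_add2l.
pose rho0 : R := 2 * (1 - 1000^-1).
have yR : 0 < y%:R :> R by rewrite ltr0n.
pose delta : R := 2 ^+ m * (D%:R / y%:R).
(* It suffices that (D/y)^240 < (2/3)^m, because (1 - 1/1000)^240 >= 2/3 by Bernoulli. Now (2/3)^m
   >= 1/(2 y^120) by the choice of m, and 2 D^240 < y^120 because y > 2 D^2. *)
have lt_delta : delta < rho0 ^+ m.
  rewrite /rho0 exprMn /delta ltr_pM2l ?exprn_gt0 //.
  have e0 : 0 < 1 - 1000^-1 :> R by lra.
  rewrite -(@ltr_pXn2r _ 240) ?nnegrE ?divr_ge0 ?ler0n ?exprn_ge0 // ?ltW //.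
  rewrite -exprM mulnC exprM.
  have b1 : 2 / 3 <= (1 - 1000^-1 : R) ^+ 240.
    have bern k : 1 - k%:R * 1000^-1 <= (1 - 1000^-1 : R) ^+ k.
      elim: k => [|k IHk]; first by rewrite mul0r subr0 expr0.
      rewrite exprS -natr1; have k0 : 0 <= k%:R :> R by rewrite ler0n.
      move: (_ ^+ k) IHk => z IHk; nra.
    by apply: le_trans (bern 240); lra.
  have b2 : (2 / 3 : R) ^+ m <= ((1 - 1000^-1 : R) ^+ 240) ^+ m.
    by apply: lerXn2r; rewrite ?nnegrE ?exprn_ge0 ?divr_ge0 // ltW.
  apply: lt_le_trans b2; rewrite !expr_div_n ltr_pdivrMr ?exprn_gt0 // mulrAC ltr_pdivlMr ?exprn_gt0 //.
  apply: (@le_lt_trans _ _ (D%:R ^+ 240 * (2 * (2 ^+ m * y%:R ^+ 120)))).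
    by rewrite ler_wpM2l ?exprn_ge0 ?ler0n // -!natrX -!natrM ler_nat.
  rewrite -[240%N]/(120 + 120)%N [y%:R ^+ (_ + _)]exprD.
  rewrite (_ : _ * _ = 2 ^+ m * (2 * D%:R ^+ (120 + 120) * y%:R ^+ 120)); last by ring.
  rewrite ltr_pM2l ?exprn_gt0 // ltr_pM2r ?exprn_gt0 //.
  rewrite -!natrX -natrM ltr_nat; apply: (@leq_ltn_trans ((2 * D ^ 2) ^ 120)).
    by rewrite expnMn -expnM leq_mul2r -[leqLHS]expn1 leq_pexp2l ?orbT.
  by rewrite ltn_exp2r.
have rho_ge : 3 / 2 <= rho0 by rewrite /rho0; lra.
have Hm (g : {ffun 'F_p * 'F_p -> R^o}) : hom0 g -> nm (iter m (@opQ _ R) g) <= delta * nm g.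
  move=> hg; apply: le_trans (nm_iter_opQ p_pr m Rad hg) _; rewrite ler_wpM2r ?nm_ge0 //.
  rewrite /delta mulrA ler_pdivlMr // mulrDl natrD mulrDr; apply: lerD.
    rewrite -ler_sqr ?nnegrE ?mulr_ge0 ?sqrtr_ge0 ?exprn_ge0 ?ler0n //.
    rewrite !exprMn sqr_sqrtr ?ler0n // -!natrX -!natrM ler_nat.
    apply: leq_trans h3 _; rewrite -[((2 ^ m) ^ 2)%N]expnM (mulnC m) expnM.
    rewrite mulnC leq_mul2l; apply/orP; right.
    by case: (C) => // c; rewrite -[leqLHS]expn1 leq_pexp2l.
  rewrite -natrX -!natrM ler_nat mulnC; apply: leq_trans h2 _.
  by rewrite mulnC leq_mul2l orbT.
apply: le_trans (two_projections rho_ge lt_delta Hm hf fR) _.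
rewrite ler_wpM2r ?ip_ge0 // ler_pdivrMr //.
have rho0_gt0 : 0 < rho0 by apply: lt_le_trans rho_ge; rewrite divr_gt0.
(* Then rho0 + 2/rho0 <= 3 - 1/500 + 1/800 = 3 (1 - 1/4000). *)
have : 2 / rho0 <= 1 + 800^-1 by rewrite ler_pdivrMr // /rho0; lra.
by move: (2 / rho0) => x; rewrite /rho0; lra.
Qed.
End Combine.

(** * Continued fractions *)

Definition cfstep (b : nat) (v : nat * nat) : nat * nat := (b * v.1 + v.2, v.1)%N.
(** The denominator and numerator of [0; w, 2]: the start (2, 1) is the fraction 1/2, so a final 2
    is appended and the last quotient is at least 2. *)
Definition cfvec (w : seq nat) := foldr cfstep (2, 1)%N w.

Lemma cfvecP w : letters12 w ->
  [/\ (0 < (cfvec w).2 < (cfvec w).1)%N, coprime (cfvec w).2 (cfvec w).1,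
      ((cfvec w).1 <= 2 * 3 ^ size w)%N &
      cf_value (w ++ [:: 2%N]) = (cfvec w).2%:R / (cfvec w).1%:R].
Proof.
elim: w => [|b w IHw].
  by rewrite /= mul1r addr0.
case/andP=> /andP[b0 b2] /IHw; rewrite /= -/(cfvec w); case: (cfvec w) => x y /= [/andP[y0 yx] co le3 ->].
have x0 := ltn_trans y0 yx; split.
- rewrite x0 /= -[X in (X < _)%N]addn0; apply: leq_ltn_trans (_ : _ <= b * x + 0)%N _.
    by rewrite !addn0 leq_pmull.
  by rewrite ltn_add2l.
- by rewrite coprime_sym /coprime gcdnC gcdnMDl gcdnC.
- apply: (@leq_trans (3 * x)); last by rewrite expnS mulnCA leq_mul2l.
  by rewrite mulSn addnC leq_add ?leq_mul2r ?b2 ?orbT // ltnW.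
rewrite natrD natrM; have xn : x%:R != 0 :> rat by rewrite pnatr_eq0 -lt0n.
rewrite -[RHS]invf_div; congr (_^-1); rewrite mulrDl mulfK //.
Qed.

Lemma cf_solution p w : letters12 w -> (p %| (cfvec w).1)%N ->
  exists q a : nat, [/\ (0 < a < q)%N, coprime a q, (q = 0 %[mod p])%N,
    (q <= 2 * 3 ^ size w)%N & partial_quotients_bounded (a%:R / q%:R) 2].
Proof.
move=> lw pq; have [h1 h2 h3 h4] := cfvecP lw.
exists (cfvec w).1, (cfvec w).2; split=> //; first by rewrite mod0n; apply/eqP.
exists (w ++ [:: 2%N]).
  split; last by rewrite h4.
    by rewrite all_cat /= andbT; apply: sub_all lw => b /andP[].
  by rewrite last_cat.
by rewrite all_cat /= andbT; apply: sub_all lw => b /andP[].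
Qed.

Lemma cfvec_Fp p w : prime p ->
  (p %| (cfvec w).1)%N = ((foldr (@cfact 'F_p) (2%:R, 1) w).1 == 0).
Proof.
move=> p_pr; have -> : foldr (@cfact 'F_p) (2%:R, 1) w = ((cfvec w).1%:R, (cfvec w).2%:R).
  elim: w => [|b w IHw] //=; rewrite IHw /cfact /mact /=; rewrite -/(cfvec w); case: (cfvec w) => x y /=.
  by rewrite natrD natrM !mul1r mul0r addr0.
by rewrite /= (dvdn_pcharf (pchar_Fp p_pr)).
Qed.

(** Used for the finitely many small primes, where no bound on the length is needed. The map A_1
    permutes the plane and sends (0, 1) to (2, 1) in three steps; continuing along the cycle leads
    back to (0, 1), whose first coordinate is 0. *)
Lemma some_word p : prime p -> exists2 w, letters12 w & (p %| (cfvec w).1)%N.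
Proof.
move=> p_pr; have p1 := prime_gt1 p_pr.
pose s : 'F_p * 'F_p -> 'F_p * 'F_p := @cfact 'F_p 1.
have s_inj : injective s by apply: bij_inj (mact_bij (mA_neq0 _ 1)).
pose e : 'F_p * 'F_p := (0, 1).
pose N := (order s e * 3)%N.
have N3 : (3 <= N)%N by rewrite -[leqLHS]mul1n leq_mul2r order_gt0.
have itN : iter N s e = e by rewrite /N mulnC iterM /= !(iter_order s_inj).
exists (nseq (N - 3) 1%N); first by rewrite /letters12 all_nseq orbT.
rewrite cfvec_Fp //.
have -> : foldr (@cfact 'F_p) (2%:R, 1) (nseq (N - 3) 1%N) = iter (N - 3) s (2%:R, 1).
  by elim: (N - 3)%N => //= k ->.
have -> : (2%:R, 1) = iter 3 s e.
  by rewrite /= /s /cfact /mact /= !mul1r !mul0r !addr0 !add0r.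
by rewrite -iterD subnK // itN.
Qed.

(** * Choice of the word length and of the constants *)

Section Main.
Variable R : realType.

Lemma half_power (kappa : R) : 0 < kappa <= 1 -> exists N : nat, (1 - kappa) ^+ N <= 2^-1.
Proof.
move=> /andP[k0 k1]; pose N := Num.bound (kappa^-1); exists N.
have N_ge : 1 <= N%:R * kappa.
  by rewrite -ler_pdivrMr // div1r ltW // archi_boundP // invr_ge0 ltW.
have bern n : 1 + n%:R * kappa <= (1 + kappa) ^+ n.
  elim: n => [|n IHn]; first by rewrite mul0r addr0 expr0.
  rewrite exprS -natr1; have n0 : 0 <= n%:R :> R by rewrite ler0n.
  move: (_ ^+ n) IHn => z IHn; nra.
have le2 : 2 <= (1 + kappa) ^+ N by apply: le_trans (bern N); lra.
have le1 : (1 - kappa) ^+ N * (1 + kappa) ^+ N <= 1.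
  rewrite -exprMn; apply: exprn_ile1; nra.
have := exprn_ge0 N (_ : 0 <= 1 - kappa); rewrite subr_ge0 => /(_ k1).
move: (_ ^+ N) (_ ^+ N) le2 le1 => x y le2 le1 x0; nra.
Qed.

Lemma large_primes : exists p0 N, forall p, prime p -> (p0 <= p)%N ->
  exists w, [/\ letters12 w, (p %| (cfvec w).1)%N & (3 ^ size w <= (2 * p) ^ N)%N].
Proof.
have [p0 Hp0] := gap_Fp R.
pose kappa : R := (4000^-1) ^+ 2 / 12800.
have kappa01 : 0 < kappa <= 1.
  rewrite divr_gt0 ?exprn_gt0 ?invr_gt0 //= ler_pdivrMr // mul1r.
  apply: (@le_trans _ _ 1); last by rewrite ler1n.
  by rewrite exprn_ile1 ?invr_ge0 // invf_le1 // ler1n.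
have [N HN] := half_power kappa01; have /andP[k0 k1] := kappa01.
exists p0, (16 * N)%N => p p_pr p_ge.
have p_gt0 := prime_gt0 p_pr.
pose l := (trunc_log 2 p).+1.
have [l_lo l_hi] : (2 ^ l <= 2 * p)%N /\ (p < 2 ^ l)%N.
  have /andP[lo hi] := trunc_log_bounds (isT : (1 < 2)%N) p_gt0.
  by split=> //; rewrite /l expnS leq_mul2l.
have gapP (f : {ffun 'F_p * 'F_p -> R^o}) : hom0 f ->
    ip (opP (opP f)) (opP (opP f)) <= (1 - kappa) * ip f f.
  apply: opP_gap; first by rewrite invr_gt0 ltr0n invf_le1 ?ler1n ?ltr0n.
  exact: Hp0.
(* Since (1 - kappa)^N <= 1/2, this length gives a decay by 2^(-4l), and (p(p+1))^2 < 2^(4l). The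
   word has 8Nl letters, so 3^(8Nl) <= 4^(8Nl) = (2^l)^(16N) <= (2p)^(16N). *)
have [||w [sw lw w0]] := @path_to_zero 'F_p R kappa (N * (4 * l)) (2%:R, 1) gapP _ k1 _.
- rewrite card_Fp // exprM.
  apply: (@le_lt_trans _ _ ((2^-1) ^+ (4 * l) * (p%:R * (p%:R + 1)) ^+ 2)).
    rewrite ler_wpM2r ?sqr_ge0 //; apply: lerXn2r; rewrite ?nnegrE ?exprn_ge0 ?invr_ge0 ?subr_ge0 //.
  rewrite exprVn mulrC ltr_pdivrMr ?exprn_gt0 // mul1r natr1 -natrM -!natrX ltr_nat.
  rewrite (_ : 4 * l = (l + l) * 2)%N; last by ring.
  rewrite expnM ltn_exp2r // expnD; apply: (@leq_ltn_trans (p * 2 ^ l)); first by rewrite leq_mul2l l_hi orbT.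
  by rewrite ltn_mul2r expn_gt0 l_hi.
- by rewrite xpair_eqE oner_eq0 andbF.
exists w; split=> //; first by rewrite cfvec_Fp // w0.
apply: (@leq_trans ((2 ^ l) ^ (16 * N))); last by case: (16 * N)%N => // k; rewrite leq_exp2r.
rewrite sw -expnM (_ : l * (16 * N) = 2 * (2 * (N * (4 * l))))%N; last by ring.
by rewrite [leqRHS]expnM; case: (2 * (N * _))%N => // k; rewrite leq_exp2r.
Qed.

End Main.

Theorem theorem2 (R : realType) :
  exists C C0 : R, [/\ 0 < C, 0 < C0 &
    forall p : nat, prime p ->
      exists q a : nat,
        [/\ (0 < a < q)%N, coprime a q, (q = 0 %[mod p])%N,
            q%:R <= C0 * (p%:R `^ C) &
            partial_quotients_bounded (a%:R / q%:R) 2]].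
Proof.
have [p0 [N HN]] := large_primes R.
(* A common bound for the primes below [p0], to be absorbed in the multiplicative constant. *)
have [B HB] : exists B, forall p, (p < p0)%N -> prime p ->
    exists w, [/\ letters12 w, (p %| (cfvec w).1)%N & (2 * 3 ^ size w <= B)%N].
  elim: p0 {HN} => [|n [B HB]]; first by exists 0%N.
  have [n_pr|n_npr] := boolP (prime n).
    have [w lw nw] := some_word n_pr.
    exists (B + 2 * 3 ^ size w)%N => p; rewrite ltnS leq_eqVlt => /orP[/eqP -> _|pn p_pr].
      by exists w; rewrite leq_addl.
    have [w' [l1 l2 l3]] := HB p pn p_pr.
    by exists w'; split=> //; apply: leq_trans l3 (leq_addr _ _).
  exists B => p; rewrite ltnS leq_eqVlt => /orP[/eqP ->|]; last exact: HB.
  by rewrite (negbTE n_npr).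
have key p : prime p -> exists w, [/\ letters12 w, (p %| (cfvec w).1)%N &
    (2 * 3 ^ size w <= (B + 2 * 2 ^ N.+1) * p ^ N.+1)%N].
  move=> p_pr; have pN : (0 < p ^ N.+1)%N by rewrite expn_gt0 prime_gt0.
  have [p_small|p_large] := ltnP p p0.
    have [w [l1 l2 l3]] := HB p p_small p_pr; exists w; split=> //.
    by apply: leq_trans l3 _; rewrite mulnDl (leq_trans _ (leq_addr _ _)) // leq_pmulr.
  have [w [l1 l2 l3]] := HN p p_pr p_large; exists w; split=> //.
  rewrite mulnDl (leq_trans _ (leq_addl _ _)) // -mulnA leq_mul2l /= -expnMn.
  apply: leq_trans l3 _; rewrite leq_pexp2l ?muln_gt0 ?prime_gt0 ?leqnSn //.
(* The successor keeps the exponent positive even when [N] is 0. *)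
exists (N.+1)%:R, (B + 2 * 2 ^ N.+1)%:R; split; rewrite ?ltr0n ?addn_gt0 ?muln_gt0 ?expn_gt0 ?orbT //.
move=> p p_pr; have [w [lw pw sw]] := key p p_pr.
have [q [a [h1 h2 h3 h4 h5]]] := cf_solution lw pw; exists q, a; split=> //.
by rewrite powR_mulrn ?ler0n // -natrX -natrM ler_nat (leq_trans h4).
Qed.
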